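(* Let $y$ be an odd positive integer, let $s\in\left\{1,2,\frac{3(y-1)}{2}+1,\frac{3(y-1)}{2}+2,\ldots,3y-1\right\}$, and let $r=3y-1-s$. Then there exists a $(3,6)\text{-}\mathrm{HWP}(6y;r,s)$.
   Context: A $C_m$-factor of a graph $G$ is a spanning subgraph of $G$ all of whose connected components are cycles of length $m$. A decomposition of a graph is a partition of its edge set into (edge sets of) subgraphs. For integers $m,n\ge 3$, $v\geq 1$ and $r,s\geq 0$, an $(m,n)\text{-}\mathrm{HWP}(v;r,s)$ is a decomposition of the complete graph $K_v$ if $v$ is odd, or of $K_v-F$ for some $1$-factor (perfect matching) $F$ of $K_v$ if $v$ is even, into $r$ $C_m$-factors and $s$ $C_n$-factors. *)

(* Defs.v *)
From mathcomp Require Import all_boot.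

Set Implicit Arguments.
Unset Strict Implicit.
Unset Printing Implicit Defensive.

(* All graphs share the vertex set T and are given by their
   edge sets, an edge being a two-element set of vertices; thus every subgraph
   E \subset G below is spanning. *)

Section Graphs.

Variable T : finType.
Implicit Types (E F G : {set {set T}}) (V : {set T}) (x y : T).

Definition complete_graph : {set {set T}} := [set e : {set T} | #|e| == 2].

Definition adj E : rel T := [rel x y | [set x; y] \in E].

Definition component_vertices E x : {set T} := [set y | connect (adj E) x y].

Definition component_edges E x : {set {set T}} :=
  [set e in E | e \subset component_vertices E x].

(* c lists the vertices in cyclic order: next c sends the last one to the
   first. *)
Definition cycle_edges (c : seq T) : {set {set T}} :=
  [set [set x; next c x] | x in c].

Definition is_cycle (m : nat) V E : Prop :=
  exists c : seq T,
    [/\ 3 <= m, size c = m, uniq c, V = [set x in c] & E = cycle_edges c].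

Definition cycle_factor (m : nat) G E : Prop :=
  E \subset G /\
  forall x, is_cycle m (component_vertices E x) (component_edges E x).

Definition one_factor G F : Prop :=
  F \subset G /\ forall x, #|[set e in F | x \in e]| = 1.

Definition decomposition (I : finType) G (H : I -> {set {set T}}) : Prop :=
  \bigcup_(i : I) H i = G /\ forall i j, i != j -> [disjoint H i & H j].

Definition cycle_factor_decomposition (m n r s : nat) G : Prop :=
  exists H : 'I_r + 'I_s -> {set {set T}},
    [/\ decomposition G H,
        forall i : 'I_r, cycle_factor m G (H (inl i))
      & forall j : 'I_s, cycle_factor n G (H (inr j))].

End Graphs.

Arguments complete_graph T : clear implicits.

Definition HWP (m n v r s : nat) : Prop :=
  let K := complete_graph 'I_v in
  if odd v then cycle_factor_decomposition m n r s K
  else exists F : {set {set 'I_v}},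
    one_factor K F /\ cycle_factor_decomposition m n r s (K :\: F).

(* Main.v *)
(**
Double every point of a Kirkman triple system of order [3y]: each parallel class
becomes a disjoint union of octahedra, and the octahedra of a class can be split
all into two triangles and a hexagon, or all into two hexagons.  This gives every
[s >= (3y - 1) / 2].

For [s = 1, 2] write [y = 2t + 1] and single out a hole of 6 points: the other [12t]
points carry two classes with cycle lengths (3, 6), resp. (6, 6), the remaining [6t]
classes are C_3-factors of the whole point set, and the hole is filled with an
octahedron.

Both the triple systems (with a block as hole) and these designs can be put into the
groups of a Kirkman frame.  Wilson's fundamental construction yields frames from
group divisible designs, and a truncated transversal design TD(5, m) then gives
[t = 4m + h] from [m] and [h <= m].  Finitely many [t] remain, which are reached
through small explicit designs found by computer.
*)

Require Import Defs.
From mathcomp Require Import all_boot all_algebra all_field zify ring.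

Set Implicit Arguments.
Unset Strict Implicit.
Unset Printing Implicit Defensive.

(** Doubling alone stops at half the factors being hexagonal: any two pairs of opposite faces of an
    octahedron share an edge, so an octahedron never splits into two C_3-factors and each class of
    octahedra costs at least one hexagon factor. For [s = 1, 2] only one class of octahedra may
    occur. For [t > 1] the octahedra therefore come from the groups of resolvable designs of type
    6^y, one group being the hole.

    A Kirkman triple system is the same kind of object with groups of 3 points, so both are handled
    as [incomplete t] with [#|Q|] equal to 1 or 2: there are [#|Q|] partial classes, [6 * #|Q| * t]
    points outside the hole and [3 * #|Q| * t] full classes. The ratio 2 is that of a Kirkman frame,
    where a group of [2 * a] points is missed by [a] classes. Hence a frame group with
    [a = 3 * #|Q| * t_j], enlarged by the hole, accommodates [incomplete t_j] with no class left
    over, and the parameters [t_j] of the groups add up. *)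

(** The k-th element of a fibre of [pa], in enumeration order, goes to the k-th element of the same
    fibre of [pb]. This lets a design live on any carrier whose groups have the right sizes. *)
Lemma fiber_bijection (J : eqType) (A B : finType) (pa : A -> J) (pb : B -> J) :
  (forall j, #|[pred x | pa x == j]| = #|[pred y | pb y == j]|) ->
  exists f : A -> B, exists g : B -> A,
    [/\ cancel f g, cancel g f & forall x, pb (f x) = pa x].
Proof.
move=> eq_card.
pose to (X Y : finType) (px : X -> J) (py : Y -> J) y0 x :=
  nth y0 (enum [pred y | py y == px x]) (index x (enum [pred x' | px x' == px x])).
have toP (X Y : finType) (px : X -> J) (py : Y -> J) y0 x :
    (forall j, #|[pred x | px x == j]| = #|[pred y | py y == j]|) ->
    py (to X Y px py y0 x) = px x /\
    index (to X Y px py y0 x) (enum [pred y | py y == px x]) =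
    index x (enum [pred x' | px x' == px x]).
  move=> eqc; rewrite /to.
  have lt : index x (enum [pred x' | px x' == px x])
            < size (enum [pred y | py y == px x]).
    by rewrite -cardE -eqc cardE index_mem mem_enum inE.
  by split; [have := mem_nth y0 lt; rewrite mem_enum inE => /eqP
            | rewrite index_uniq ?enum_uniq].
have toK (X Y : finType) (px : X -> J) (py : Y -> J) x0 y0 :
    (forall j, #|[pred x | px x == j]| = #|[pred y | py y == j]|) ->
    cancel (to X Y px py y0) (to Y X py px x0).
  move=> eqc x; have [e1 e2] := toP X Y px py y0 x eqc.
  rewrite {1}/to e1 e2 nth_index ?mem_enum ?inE //.
(* [nth] needs a default element, so empty types are treated apart. *)
have [a0 _|noA] := pickP (fun _ : A => true); last first.
  have noB : B -> False.
    move=> b; have : 0 < #|[pred y | pb y == pb b]|.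
      by apply/card_gt0P; exists b; rewrite inE.
    by rewrite -eq_card => /card_gt0P[a]; have := noA a.
  have noA' (a : A) : False by have := noA a.
  exists (fun a => match noA' a with end).
  exists (fun b => match noB b with end).
  by split=> x; [case: (noA' x) | case: (noB x) | case: (noA' x)].
have [b0 _] : exists b : B, true.
  have : 0 < #|[pred y | pb y == pa a0]|.
    by rewrite -eq_card; apply/card_gt0P; exists a0; rewrite inE.
  by case/card_gt0P=> b _; exists b.
exists (to A B pa pb b0), (to B A pb pa a0); split.
- exact: toK.
- by apply: toK => j; rewrite eq_card.
- by move=> x; have [] := toP A B pa pb b0 x eq_card.
Qed.

Lemma card_bijection (A B : finType) : #|A| = #|B| ->
  exists f : A -> B, exists g : B -> A, cancel f g /\ cancel g f.
Proof.
move=> eqAB.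
have [|f [g [fK gK _]]] :=
  @fiber_bijection unit A B (fun=> tt) (fun=> tt); last by exists f, g.
by case; rewrite (eq_card (B := A)) // eqAB; apply/esym/eq_card.
Qed.

(** * Kirkman frames *)

(* A class is a map of order 3 that moves each point around its block.  Nothing says
   that a pair of points lies in only one block: in the end this follows by counting,
   see [cover_decomposition]. *)
Definition frame_on (J : eqType) (D : pred J) (Y C : Type) (py : Y -> J)
    (pc : C -> J) (f : C -> Y -> Y) : Prop :=
  (forall c y, D (pc c) -> D (py y) -> py y != pc c ->
     [/\ D (py (f c y)), py (f c y) != pc c, py (f c y) != py y
       & f c (f c (f c y)) = y]) /\
  (forall y z, D (py y) -> D (py z) -> py y != py z ->
     exists c, [/\ D (pc c), pc c != py y, pc c != py z & f c y = z \/ f c z = y]).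

(* Group [j] has [2 * a j] points, and [a j] classes miss exactly this group. *)
Definition frame (J : finType) (a : J -> nat) : Prop :=
  exists (Y C : finType) (py : Y -> J) (pc : C -> J) (f : C -> Y -> Y),
    [/\ forall j, #|[pred y | py y == j]| = 2 * a j,
        forall j, #|[pred c | pc c == j]| = a j
      & frame_on predT py pc f].

Lemma eq_frame (J : finType) (a b : J -> nat) : a =1 b -> frame a -> frame b.
Proof.
move=> e [Y [C [py [pc [f [cY cC P]]]]]].
by exists Y, C, py, pc, f; split=> // j; rewrite -e.
Qed.

Lemma card_sub_fiber (J : eqType) (D : pred J) (Y : finType) (py : Y -> J) (j : J) :
  #|[pred y : {y | D (py y)} | py (val y) == j]| =
  if D j then #|[pred y | py y == j]| else 0.
Proof.
rewrite -(card_image val_inj).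
case: ifP => Dj.
  apply: eq_card => y; apply/imageP/idP => [[x] | ]; rewrite !inE.
    by move=> xj ->.
  move=> /eqP yj; have Dy : D (py y) by rewrite yj.
  by exists (Sub y Dy); rewrite ?inE SubK ?yj.
apply: eq_card0 => y; apply/imageP => -[x]; rewrite !inE => /eqP xj _.
by have := valP x; rewrite /= xj Dj.
Qed.

(** Wilson's construction puts one frame on each block, all inside a single set of points and
    classes; [D] cuts out the part over one block. *)
Lemma frame_realize (J : finType) (D : pred J) (a : J -> nat) (Y C : finType)
    (py : Y -> J) (pc : C -> J) :
  frame (fun j => if D j then a j else 0) ->
  (forall j, #|[pred y | py y == j]| = 2 * a j) ->
  (forall j, #|[pred c | pc c == j]| = a j) ->
  exists f : C -> Y -> Y, frame_on D py pc f.
Proof.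
case=> Y' [C'] [py'] [pc'] [f'] [cY' cC' [f'P f'cov]] cY cC.
have [j|g [h [gK hK gP]]] :=
    @fiber_bijection J {y | D (py y)} Y' (py \o val) py'.
  by rewrite /= card_sub_fiber cY cY'; case: ifP.
have [j|gC [hC [gCK hCK gCP]]] :=
    @fiber_bijection J {c | D (pc c)} C' (pc \o val) pc'.
  by rewrite /= card_sub_fiber cC cC'; case: ifP.
have hP y : py (val (h y)) = py' y by rewrite -[in RHS](hK y) gP.
have hCP c : pc (val (hC c)) = pc' c by rewrite -[in RHS](hCK c) gCP.
exists (fun c y => match insub c, insub y with
  | Some c0, Some y0 => val (h (f' (gC c0) (g y0))) | _, _ => y end).
split=> [c y Dc Dy ycN | y z Dy Dz yzN].
  rewrite (insubT (fun c => D (pc c)) Dc) (insubT (fun y => D (py y)) Dy).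
  set c0 := Sub c Dc; set y0 := Sub y Dy.
  have yc : py' (g y0) != pc' (gC c0) by rewrite gP gCP.
  have [_ e1 e2 e3] := f'P (gC c0) (g y0) isT isT yc.
  rewrite !hP !valK !hK e3 gK.
  by split=> //; [rewrite -hP (valP (h _)) | rewrite gCP in e1 | rewrite gP in e2].
set y0 : {y | D (py y)} := Sub y Dy; set z0 : {y | D (py y)} := Sub z Dz.
have yz : py' (g y0) != py' (g z0) by rewrite !gP.
have [c [_ c1 c2 cP]] := f'cov _ _ isT isT yz.
have Dc := valP (hC c).
exists (val (hC c)); rewrite Dc hCP valK !insubT hCK; rewrite !gP in c1 c2; split=> //.
rewrite -/y0 -/z0.
by case: cP => ->; [left | right]; rewrite gK.
Qed.

(** Empty groups put no condition on a frame, so the index set may be enlarged; this pads a frame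
    over the points of one block to all points. *)
Lemma frame_inj (J J' : finType) (a : J -> nat) (a' : J' -> nat) (h : J -> J') :
  injective h -> (forall j, a' (h j) = a j) ->
  (forall j', (forall j, h j != j') -> a' j' = 0) ->
  frame a -> frame a'.
Proof.
move=> h_inj a'h a'0 [Y] [C] [py] [pc] [f] [cY cC [fP fcov]].
have fib (X : finType) (p : X -> J) k : (forall j, #|[pred x | p x == j]| = k * a j) ->
    forall j', #|[pred x | h (p x) == j']| = k * a' j'.
  move=> cX j'; have [j /eqP <-|noj] := pickP (fun j => h j == j').
    by rewrite a'h -cX; apply: eq_card => x; rewrite !inE inj_eq.
  rewrite a'0 ?muln0; first by apply: eq_card0 => x; rewrite !inE noj.
  by move=> j; rewrite noj.
exists Y, C, (h \o py), (h \o pc), f; split.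
- exact: fib.
- by move=> j; rewrite -[RHS]mul1n; apply: fib => i; rewrite mul1n.
split=> [c y _ _ | y z _ _] /=; rewrite ?(inj_eq h_inj) // => ne.
  by have [_ ? ? ?] := fP c y isT isT ne.
by have [c [_ ? ? ?]] := fcov y z isT isT ne; exists c; rewrite /= !(inj_eq h_inj).
Qed.

Definition uniform_frame (k w : nat) : Prop := frame (fun _ : 'I_k => w).

Lemma frame_uniform (J : finType) (D : pred J) (w : nat) :
  uniform_frame #|D| w -> frame (fun j => if D j then w else 0).
Proof.
apply: (@frame_inj _ _ _ _ (@enum_val J D)); first exact: enum_val_inj.
  by move=> i; have := enum_valP i; rewrite unfold_in => ->.
move=> j ne; case: ifP => // Dj.
by have := ne (enum_rank_in (A := D) Dj j); rewrite enum_rankK_in ?eqxx.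
Qed.

(** Block sizes are left free, because truncation mixes blocks of 4 and 5 points. *)
Definition gdd (M J : eqType) (B : Type) (grp : M -> J) (inc : M -> B -> bool) : Prop :=
  [/\ forall x y, grp x != grp y -> exists b, inc x b /\ inc y b,
      forall x y b b', x != y -> inc x b -> inc y b -> inc x b' -> inc y b' -> b = b'
    & forall x y b, x != y -> inc x b -> inc y b -> grp x != grp y].

Lemma card_fiber_comp (M J : finType) (Y : finType) (grp : M -> J) (py : Y -> M) (j : J) :
  #|[pred y | grp (py y) == j]| = \sum_(m | grp m == j) #|[pred y | py y == m]|.
Proof.
rewrite -sum1_card (partition_big py (fun m => grp m == j)) //=.
apply: eq_bigr => m /eqP mj; rewrite -sum1_card; apply: eq_bigl => y; rewrite !inE.
by have [->|] := eqVneq (py y) m; rewrite ?andbF // mj eqxx.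
Qed.

(** A class over [m] moves a point over [m'] inside the frame of the one block through [m] and [m'].
    If [m] and [m'] share a group there is no such block, and so the classes over a group miss
    exactly that group. *)
Lemma wilson (M J B : finType) (grp : M -> J) (inc : M -> B -> bool) (a : M -> nat) :
  gdd grp inc -> (forall b, frame (fun m => if inc m b then a m else 0)) ->
  frame (fun j => \sum_(m | grp m == j) a m).
Proof.
case=> g1 g2 g3 frb.
pose Y := {m : M & 'I_(2 * a m)}; pose C := {m : M & 'I_(a m)}.
have card_tag k m : #|[pred y : {m : M & 'I_(k m)} | tag y == m]| = k m.
  rewrite -[RHS]card_ord -(card_image (f := @Tagged M m (fun m => 'I_(k m)))).
    apply: eq_card => y; rewrite inE; apply/eqP/imageP => [<-|[i _ ->]] //.
    by exists (tagged y); case: y.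
  by move=> x y /eqP; rewrite eq_Tagged => /eqP.
have cY : forall m, #|[pred y : Y | tag y == m]| = 2 * a m by apply: card_tag.
have cC : forall m, #|[pred y : C | tag y == m]| = a m by apply: card_tag.
have /fin_all_exists[f fP] b : exists f : C -> Y -> Y,
    frame_on (fun m => inc m b) (@tag _ _) (@tag _ _) f.
  by have := frame_realize (frb b) cY cC.
pose F c y := if [pick b | inc (tag c) b && inc (tag y) b] is Some b
              then f b c y else y.
have FE c y b : tag y != tag c -> inc (tag c) b -> inc (tag y) b -> F c y = f b c y.
  move=> ne cb yb; rewrite /F; case: pickP => [b' /andP[cb' yb']|/(_ b)].
    by rewrite (g2 _ _ b' b ne).
  by rewrite cb yb.
exists Y, C, (grp \o tag), (grp \o tag), F; split.
- move=> j; rewrite (card_fiber_comp grp (fun y : Y => tag y)) big_distrr.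
  by apply: eq_bigr => m _; rewrite cY.
- move=> j; rewrite (card_fiber_comp grp (fun y : C => tag y)).
  by apply: eq_bigr => m _; rewrite cC.
split=> [c y _ _ /= ne | y z _ _ /= ne].
  have [b [yb cb]] := g1 _ _ ne.
  have ne' : tag y != tag c by apply: contraNneq ne => ->.
  have [P _] := fP b; rewrite (FE c y b) //.
  have [y1b y1c y1y y3] := P c y cb yb ne'.
  have [y2b y2c _ _] := P c _ cb y1b y1c.
  by rewrite !(FE c _ b) // y3; split=> //; apply: g3 (b) _ _ _.
have [b [yb zb]] := g1 _ _ ne.
have ne' : tag y != tag z by apply: contraNneq ne => ->.
have [_ /(_ y z yb zb ne')[c [cb cy cz cE]]] := fP b.
exists c; rewrite (g3 _ _ b cy) // (g3 _ _ b cz) //; split=> //.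
by rewrite !(FE c _ b) // eq_sym.
Qed.

(** Points off [E] get weight 0: this is truncation, and only the points of a block in [E] count
    towards its size. *)
Lemma uniform_wilson (M J B : finType) (grp : M -> J) (inc : M -> B -> bool)
    (E : pred M) (w : nat) :
  gdd grp inc -> (forall b, uniform_frame #|[pred m | E m && inc m b]| w) ->
  frame (fun j => #|[pred m | E m && (grp m == j)]| * w).
Proof.
move=> g frb.
apply: (@eq_frame _ (fun j => \sum_(m | grp m == j) if E m then w else 0)) => [j|].
  rewrite -big_mkcondr sum_nat_const; congr (_ * _); apply: eq_card => m.
  by rewrite !inE andbC.
apply: wilson g _ => b; apply: eq_frame (frame_uniform (frb b)) => m.
by rewrite inE; case: (E m); case: (inc m b).
Qed.

Definition cycles_of_length (T : Type) (D : pred T) (L : nat) (f : T -> T) : Prop :=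
  forall x, D x ->
    [/\ D (f x), iter L f x = x & forall i, 0 < i < L -> iter i f x <> x].

Definition joined (T : eqType) (f : T -> T) (x y : T) : bool :=
  (f x == y) || (f y == x).

(** * Designs with a hole *)

Section Incomplete.

Variables (W Q : finType) (L : Q -> nat) (fixed : bool).

(** Full classes use no pair inside the hole, so these pairs stay free for the filling. *)
Definition allowed (Y : eqType) (phi : Y -> Y) (u v : Y + W) : bool :=
  match u, v with
  | inl y, inl z => (z != y) && (z != phi y)
  | inr _, inr _ => false
  | _, _ => true
  end.

Definition outer (Y : Type) (D : pred Y) (u : Y + W) : bool :=
  if u is inl y then D y else true.

(* [Y] is the set of points outside the hole [W]; the classes in [C] consist of
   triangles and span [Y + W], those in [Q] span [Y] only.  The uncovered pairs
   [{y, phi y}] form a 1-factor of [Y], or there are none when [fixed]. *)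
Record incomplete_on (Y C : eqType) (DY : pred Y) (DC : pred C) (phi : Y -> Y)
    (f : C -> Y + W -> Y + W) (h : Q -> Y -> Y) : Prop := Incomplete {
  inc_phi : forall y, DY y ->
    [/\ DY (phi y), phi (phi y) = y & (phi y == y) = fixed];
  inc_full : forall c u, DC c -> outer DY u ->
    [/\ outer DY (f c u), f c (f c (f c u)) = u & allowed phi u (f c u)];
  inc_part : forall q, cycles_of_length DY (L q) (h q);
  inc_partN : forall q y, DY y -> h q y != phi y;
  inc_coverYY : forall y z, DY y -> DY z -> z != y -> z != phi y ->
    (exists2 c, DC c & joined (f c) (inl y) (inl z)) \/ (exists q, joined (h q) y z);
  inc_coverYW : forall y w, DY y -> exists2 c, DC c & joined (f c) (inl y) (inr w)
}.

Definition incomplete (t : nat) : Prop :=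
  exists (Y C : finType) (phi : Y -> Y) (f : C -> Y + W -> Y + W) (h : Q -> Y -> Y),
    [/\ #|Y| = 6 * #|Q| * t, #|C| = 3 * #|Q| * t
      & incomplete_on predT predT phi f h].

(** [DY] and [DC] will be the points of one frame group and the classes that miss it. *)
Lemma incomplete_realize (t : nat) (Y C : finType) (DY : pred Y) (DC : pred C) :
  incomplete t -> #|DY| = 6 * #|Q| * t -> #|DC| = 3 * #|Q| * t ->
  exists phi f h, incomplete_on DY DC phi f h.
Proof.
case=> Y' [C'] [phi'] [f'] [h'] [cY' cC' [P1 P2 P3 P4 P5 P6]] cY cC.
have [|g [k [gK kK]]] := @card_bijection {y | DY y} Y'; first by rewrite card_sig cY.
have [|gC [kC [gCK kCK]]] := @card_bijection {c | DC c} C'; first by rewrite card_sig cC.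
pose lift (e : Y' -> Y') y := if insub y is Some y0 then val (k (e (g y0))) else y.
pose toY u : Y + W := match u with inl y => inl (val (k y)) | inr w => inr w end.
pose ofY (u : Y + W) : option (Y' + W) :=
  match u with inl y => omap (fun y0 => inl (g y0)) (insub y) | inr w => Some (inr w) end.
pose F c u := match insub c, ofY u with
  | Some c0, Some u0 => toY (f' (gC c0) u0) | _, _ => u end.
have DYk y : DY (val (k y)) by apply: valP.
have liftE e y : lift e (val (k y)) = val (k (e y)) by rewrite /lift valK kK.
have ofYK u : ofY (toY u) = Some u by case: u => //= y; rewrite valK /= kK.
have FE c u : F (val (kC c)) (toY u) = toY (f' c u) by rewrite /F valK ofYK kCK.
have toY_inj : injective toY by move=> u v /(congr1 ofY); rewrite !ofYK => -[].
have DYP y : DY y -> exists y', y = val (k y').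
  by move=> Dy; exists (g (Sub y Dy)); rewrite gK SubK.
have DCP c : DC c -> exists c', c = val (kC c').
  by move=> Dc; exists (gC (Sub c Dc)); rewrite gCK SubK.
have DuP u : outer DY u -> exists u', u = toY u'.
  by case: u => [y /DYP[y' ->]|w _]; [exists (inl y') | exists (inr w)].
have outerT u : outer DY (toY u) by case: u => //= y.
have k_inj : injective (fun y => val (k y)) by move=> x y /val_inj /(can_inj kK).
have iterE n e y : iter n (lift e) (val (k y)) = val (k (iter n e y)).
  by elim: n => //= n ->; rewrite liftE.
have joinedF c u v : joined (F (val (kC c))) (toY u) (toY v) = joined (f' c) u v.
  by rewrite /joined !FE !(inj_eq toY_inj).
have joinedh q y z : joined (lift (h' q)) (val (k y)) (val (k z)) = joined (h' q) y z.
  by rewrite /joined !liftE !(inj_eq k_inj).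
exists (lift phi'), F, (fun q => lift (h' q)); split.
- move=> _ /DYP[y ->]; have [_ e1 e2] := P1 y isT.
  by rewrite !liftE e1 (inj_eq k_inj).
- move=> _ _ /DCP[c ->] /DuP[u ->]; have [_ e1 e2] := P2 c u isT (ltac:(by case: u)).
  rewrite !FE e1; split=> //; move: e2.
  by case: u {e1} => [y|w]; case: (f' c _) => //= z; rewrite liftE !(inj_eq k_inj).
- move=> q _ /DYP[y ->]; have [_ e1 e2] := P3 q y isT; rewrite liftE iterE e1.
  by split=> // i /e2 ne; rewrite iterE => /k_inj.
- by move=> q _ /DYP[y ->]; rewrite !liftE (inj_eq k_inj) P4.
- move=> _ _ /DYP[y ->] /DYP[z ->]; rewrite liftE !(inj_eq k_inj) => n1 n2.
  have [[c _ j]|[q j]] := P5 y z isT isT n1 n2.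
    by left; exists (val (kC c)); [apply: valP | rewrite (joinedF _ (inl y) (inl z))].
  by right; exists q; rewrite joinedh.
- move=> _ w /DYP[y ->]; have [c _ j] := P6 y w isT.
  by exists (val (kC c)); [apply: valP | rewrite (joinedF _ (inl y) (inr w))].
Qed.

(** Each of the [3 * #|Q| * t j] frame classes missing group [j] is completed by a full class of the
    design on group [j] and the hole; the partial classes of the groups are united. The frame joins
    points of different groups, the inserted designs do the rest. *)
Lemma incomplete_fill (J : finType) (t : J -> nat) :
  frame (fun j => 3 * #|Q| * t j) -> (forall j, incomplete (t j)) ->
  incomplete (\sum_j t j).
Proof.
case=> Y [C] [py] [pc] [g] [cY cC [gP gcov]] iks.
have cY' j : #|[pred y | py y == j]| = 6 * #|Q| * t j by rewrite cY; lia.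
have /fin_all_exists[phi /fin_all_exists[f /fin_all_exists[h P]]] j :=
  incomplete_realize (iks j) (cY' j) (cC j).
pose F c u := match u with
  | inl y => if py y == pc c then f (pc c) c u else inl (g c y)
  | inr _ => f (pc c) c u end.
have inF c u : outer [pred y | py y == pc c] u -> F c u = f (pc c) c u.
  by case: u => //= y ->.
exists Y, C, (fun y => phi (py y) y), F, (fun q y => h (py y) q y); split.
- rewrite big_distrr /= -sum1_card (partition_big py predT) //=.
  by apply: eq_bigr => j _; rewrite -cY' -sum1_card; apply: eq_bigl.
- rewrite big_distrr /= -sum1_card (partition_big pc predT) //=.
  by apply: eq_bigr => j _; rewrite -cC -sum1_card; apply: eq_bigl.
have phi_py y : py (phi (py y) y) = py y.
  by have [/eqP] := inc_phi (P (py y)) (eqxx (py y)).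
split.
- move=> y _; have [/= /eqP e1 e2 e3] := inc_phi (P (py y)) (eqxx (py y)).
  by rewrite e1 e2.
- move=> c u _ _; split; first by case: (F c u).
  + have [|nin] := boolP (outer [pred y | py y == pc c] u).
      move=> inu; have [in1 e1 _] := inc_full (P (pc c)) (eqxx (pc c)) inu.
      have [in2 _ _] := inc_full (P (pc c)) (eqxx (pc c)) in1.
      by rewrite !inF.
    case: u nin => //= y ne; rewrite (negbTE ne).
    have [_ n1 _ e] := gP c y isT isT ne; have [_ n2 _ _] := gP c _ isT isT n1.
    by rewrite /= (negbTE n1) /= (negbTE n2) e.
  + have [|nin] := boolP (outer [pred y | py y == pc c] u).
      move=> inu; have [_ _] := inc_full (P (pc c)) (eqxx (pc c)) inu.
      rewrite inF //; case: u inu => //= y /eqP -> .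
      by case: (f _ _ _).
    case: u nin => //= y ne; rewrite (negbTE ne).
    have [_ _ n1 e] := gP c y isT isT ne.
    by rewrite /allowed; apply/andP; split; apply: contraNneq n1 => ->; rewrite ?phi_py.
- move=> q y _.
  (* The map is selected anew by [py] at each step, so the orbit must first be seen to stay in one
     group. *)
  have hin n : py (iter n (fun y => h (py y) q y) y) = py y /\
      iter n (fun y => h (py y) q y) y = iter n (h (py y) q) y.
    elim: n => //= n [e1 e2]; rewrite e1 e2.
    have := inc_part (P (py y)) q (x := iter n (h (py y) q) y).
    by rewrite /= -e2 e1 eqxx => /(_ isT)[/eqP].
  have [_ e1 e2] := inc_part (P (py y)) q (eqxx (py y)).
  by split=> // [|i /e2]; rewrite (hin _).2.
- by move=> q y _; apply: (inc_partN (P (py y))); rewrite /= eqxx.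
- move=> y z _ _ n1 n2; have [e|ne] := eqVneq (py y) (py z).
    have [|[c /= /eqP c1 c2]|[q qP]] :=
        inc_coverYY (P (py y)) (eqxx (py y)) _ n1 n2; first by rewrite /= e.
      have iy : outer [pred y | py y == pc c] (inl y) by rewrite /= c1.
      have iz : outer [pred y | py y == pc c] (inl z) by rewrite /= c1 e.
      by left; exists c; rewrite // /joined (inF _ _ iy) (inF _ _ iz) c1.
    by right; exists q; rewrite /joined -e.
  have [c [_ c1 c2 cE]] := gcov y z isT isT ne; left; exists c => //.
  rewrite /joined /F !(eq_sym (py _)) (negbTE c1) (negbTE c2).
  by case: cE => ->; rewrite eqxx ?orbT.
- move=> y w _; have [c /= /eqP c1 c2] := inc_coverYW (P (py y)) w (eqxx (py y)).
  have iy : outer [pred y | py y == pc c] (inl y) by rewrite /= c1.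
  by exists c; rewrite // /joined (inF _ _ iy) inF // c1.
Qed.

End Incomplete.

(** * Group divisible designs *)

Lemma count_le1_inj (T : Type) (x0 : T) (a : pred T) (s : seq T) (i j : nat) :
  count a s <= 1 -> i < size s -> j < size s -> a (nth x0 s i) -> a (nth x0 s j) ->
  i = j.
Proof.
have pos s' k : k < size s' -> a (nth x0 s' k) -> 0 < count a s'.
  by move=> lk ak; rewrite -has_count; apply/(has_nthP x0); exists k.
elim: s i j => // x s IH [|i] [|j] //= le1 li lj ai aj.
- by have := pos _ _ lj aj; rewrite ai in le1; lia.
- by have := pos _ _ li ai; rewrite aj in le1; lia.
- by congr _.+1; apply: IH => //; lia.
Qed.

Lemma card_ord_count (n : nat) (p : pred nat) :
  #|[pred x : 'I_n | p x]| = count p (iota 0 n).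
Proof.
by rewrite cardE /enum_mem size_filter -val_enum_ord count_map enumT; apply: eq_count.
Qed.

Definition gdd_table (k n g : nat) (grp : nat -> nat) (bl : seq (seq nat)) : bool :=
  [&& all (fun x => grp x <= g) (iota 0 n),
      all (fun b => count (fun x => x \in b) (iota 0 n) == k) bl
    & all (fun x => all (fun y => (x == y) ||
        (count (fun b => (x \in b) && (y \in b)) bl == (grp x != grp y))) (iota 0 n))
      (iota 0 n)].

Lemma table_gdd (k n g : nat) (grp : nat -> nat) (bl : seq (seq nat)) :
  gdd_table k n g grp bl ->
  gdd (fun x : 'I_n => inord (grp x) : 'I_g.+1)
      (fun x (b : 'I_(size bl)) => val x \in nth [::] bl b).
Proof.
case/and3P=> /allP grp_le _ /allP pairs.
have inI (x : 'I_n) : val x \in iota 0 n by rewrite mem_iota add0n /=.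
have cnt (x y : 'I_n) : x != y ->
    count (fun b => (val x \in b) && (val y \in b)) bl = (grp x != grp y).
  rewrite -val_eqE => ne; have /allP/(_ _ (inI y)) := pairs _ (inI x).
  by rewrite (negbTE ne) => /eqP.
have grpE (x y : 'I_n) : (inord (grp x) == inord (grp y) :> 'I_g.+1) = (grp x == grp y).
  by rewrite -val_eqE /= !inordK // ltnS grp_le // inI.
split=> [x y | x y b b' ne xb yb xb' yb' | x y b ne xb yb]; rewrite ?grpE.
- move=> ne; have nexy : x != y by apply: contraNneq ne => ->.
  have : has (fun b => (val x \in b) && (val y \in b)) bl by rewrite has_count cnt ?ne.
  by case/(has_nthP [::]) => i lt /andP[xb yb]; exists (Ordinal lt).
- pose a (c : seq nat) := (val x \in c) && (val y \in c).
  apply/val_inj/(@count_le1_inj _ [::] a bl _ _ _ (ltn_ord b) (ltn_ord b')).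
  + by rewrite (cnt x y ne); case: (_ != _).
  + by rewrite /a xb yb.
  + by rewrite /a xb' yb'.
have : 0 < count (fun b => (val x \in b) && (val y \in b)) bl.
  by rewrite -has_count; apply/(has_nthP [::]); exists b; rewrite ?xb ?yb.
by rewrite (cnt x y ne); case: (_ != _).
Qed.

Lemma table_frame (k n g w : nat) (grp : nat -> nat) (bl : seq (seq nat)) :
  gdd_table k n g grp bl -> uniform_frame k w ->
  frame (fun j : 'I_g.+1 => count (fun x => grp x == j) (iota 0 n) * w).
Proof.
move=> tab frk; have /and3P[/allP grp_le /allP blk _] := tab.
apply: (eq_frame _ (uniform_wilson (E := predT) (w := w) (table_gdd tab) _)) => [j | b].
  congr (_ * _); rewrite -card_ord_count; apply: eq_card => x.
  have le : grp x <= g by apply: grp_le; rewrite mem_iota add0n ltn_ord.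
  by rewrite !inE -val_eqE /= inordK.
rewrite (_ : #|_| = k) // -(eqP (blk _ (mem_nth [::] (ltn_ord b)))) -card_ord_count.
by apply: eq_card => x.
Qed.

Section Closure.

Variables (W Q : finType) (L : Q -> nat) (fixed : bool).

Local Notation incomplete := (incomplete W L fixed).

(** Divisibility by 3 makes the [c j * #|Q|] classes missing group [j] exactly as many as the full
    classes of [incomplete (c j %/ 3)]. *)
Lemma table_incomplete (k n g w : nat) (grp : nat -> nat) (bl : seq (seq nat)) :
  let c j := count (fun x => grp x == j) (iota 0 n) * w in
  gdd_table k n g grp bl && all (fun j => 3 %| c j) (iota 0 g.+1) ->
  uniform_frame k (w * #|Q|) ->
  (forall j, j \in iota 0 g.+1 -> incomplete (c j %/ 3)) ->
  incomplete (sumn [seq c j %/ 3 | j <- iota 0 g.+1]).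
Proof.
move=> c /andP[tab /allP dvd3] frk iks.
have inI (j : 'I_g.+1) : val j \in iota 0 g.+1 by rewrite mem_iota add0n /=.
have e0 : iota 0 g.+1 = index_iota 0 g.+1 by rewrite /index_iota subn0.
rewrite sumnE big_map e0 big_mkord; apply: incomplete_fill => [|j]; last exact: iks (inI j).
apply: eq_frame (table_frame tab frk) => j.
by rewrite /= mulnA -[_ * w]/(c j) -{1}(divnK (dvd3 _ (inI j))); lia.
Qed.

End Closure.

(** * Truncated transversal designs over rings *)

Section Transversal.
Import GRing.Theory.
Local Open Scope ring_scope.

(* The transversal design whose groups are pairwise distinct points [(u i : v i)] of
   the projective line over [R]. *)
Definition pencil (R : nzRingType) (I : Type) (u v : I -> R) (x : I * R) (b : R * R) : bool :=
  x.2 == b.1 * u x.1 + b.2 * v x.1.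

(** The values of a block in two groups determine it through a 2 x 2 linear system with invertible
    determinant, solved by Cramer's rule. *)
Lemma pencil_gdd (R : comUnitRingType) (I : eqType) (u v : I -> R) :
  (forall i j, i != j -> u i * v j - u j * v i \is a GRing.unit) ->
  gdd (fun x : I * R => x.1) (pencil u v).
Proof.
move=> du; split=> [[i x] [j y] /= ij | [i x] [j y] [a b] [a' b'] | [i x] [j y] [a b]].
- set d := u i * v j - u j * v i; have dU : d \is a GRing.unit := du i j ij.
  exists ((x * v j - y * v i) / d, (u i * y - u j * x) / d).
  by rewrite /pencil /=; split; apply/eqP;
    [rewrite -[LHS](mulrK dU) | rewrite -[LHS](mulrK dU)]; rewrite /d; set e := _^-1; ring.
- rewrite /pencil /=; have [<-|ij] := eqVneq i j.
    by move=> ne /eqP xE /eqP yE; rewrite xE yE eqxx in ne.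
  move=> _ /eqP xE /eqP yE /eqP xE' /eqP yE'; have dU := du i j ij.
  have xx : a * u i + b * v i = a' * u i + b' * v i by rewrite -xE -xE'.
  have yy : a * u j + b * v j = a' * u j + b' * v j by rewrite -yE -yE'.
  congr (_, _); apply: (mulIr dU).
    transitivity ((a * u i + b * v i) * v j - (a * u j + b * v j) * v i); first by ring.
    by rewrite xx yy; ring.
  transitivity ((a * u j + b * v j) * u i - (a * u i + b * v i) * u j); first by ring.
  by rewrite xx yy; ring.
- rewrite /pencil /=; have [<-|//] := eqVneq i j.
  by move=> ne /eqP xE /eqP yE; rewrite xE yE eqxx in ne.
Qed.

End Transversal.

(** A block of a transversal design is the graph of a function on the groups; this counts its
    surviving points. *)
Lemma card_graph (I R : finType) (E : pred (I * R)) (f : I -> R) :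
  #|[pred m : I * R | E m && (m.2 == f m.1)]| = #|[pred i | E (i, f i)]|.
Proof.
rewrite -(card_image (f := fun i => (i, f i))) => [|i j [] //].
apply: eq_card => -[i x]; rewrite !inE; apply/andP/imageP => [[ij /eqP /= xf]|[j]].
  by exists i; rewrite ?inE -?xf ?ij.
by rewrite inE => Ej [-> ->].
Qed.

Lemma card_rank_lt (R : finType) (h : nat) :
  h <= #|R| -> #|[pred x : R | enum_rank x < h]| = h.
Proof.
move=> hR; rewrite -[LHS](card_image (@enum_rank_inj R)).
transitivity #|[pred i : 'I_#|R| | i < h]|.
  apply: eq_card => i; rewrite inE; apply/imageP/idP => [[x]|ih'].
    by rewrite inE => xh ->.
  by exists (enum_val i); rewrite ?inE enum_valK.
rewrite (card_ord_count _ (fun i => i < h)) -size_filter.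
by rewrite (filter_iota_ltn 0 hR) size_iota.
Qed.

Section TransversalClosure.

Variables (W Q : finType) (L : Q -> nat) (fixed : bool).

Local Notation incomplete := (incomplete W L fixed).

(** Only [h] points of the last group are kept, so a block has 5 or 4 points according to whether
    its last point survives. Weight [3 * #|Q|] makes a group of [t j] points fit
    [incomplete (t j)]. *)
Lemma transversal_incomplete (R : finComUnitRingType) (u v : 'I_5 -> R) (h : nat) :
  (forall i j, i != j -> (u i * v j - u j * v i)%R \is a GRing.unit) ->
  h <= #|R| -> uniform_frame 4 (3 * #|Q|) -> uniform_frame 5 (3 * #|Q|) ->
  incomplete #|R| -> incomplete h -> incomplete (4 * #|R| + h).
Proof.
move=> du hR fr4 fr5 iR ih.
pose E (m : 'I_5 * R) := (m.1 != ord_max) || (enum_rank m.2 < h).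
pose t (j : 'I_5) := if j == ord_max then h else #|R|.
have cE j : #|[pred m | E m && (m.1 == j)]| = t j.
  transitivity #|[pred x | E (j, x)]|.
    rewrite -(card_image (f := fun x : R => (j, x))) => [|x y [] //].
    apply: eq_card => -[i x]; rewrite !inE; apply/andP/imageP => [[Ei /eqP /= <-]|[y]].
      by exists x.
    by rewrite inE => Ey [-> ->].
  rewrite /t /E /=; have [_|_] := eqVneq j ord_max; last exact: eq_card.
  exact: card_rank_lt.
rewrite (_ : 4 * #|R| + h = \sum_j t j); last first.
  by rewrite big_ord_recr /= /t eqxx; congr (_ + _); rewrite !big_ord_recr big_ord0 /=; lia.
apply: incomplete_fill => [|j]; last by rewrite /t; case: ifP.
apply: (eq_frame _ (uniform_wilson (pencil_gdd du) (E := E) (w := 3 * #|Q|) _)) => [j|b].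
  by rewrite cE mulnC.
rewrite (card_graph E (fun i => b.1 * u i + b.2 * v i)%R).
case last5 : (E (ord_max, (b.1 * u ord_max + b.2 * v ord_max)%R)).
  rewrite (eq_card (B := predT)) ?card_ord // => i; rewrite !inE.
  by have [->|ne] := eqVneq i ord_max; rewrite ?last5 // /E ne.
rewrite (eq_card (B := predC1 ord_max)) ?cardC1 ?card_ord // => i; rewrite !inE.
by have [->|ne] := eqVneq i ord_max; rewrite ?last5 // /E ne.
Qed.

(** For the points [(1 : i)], [i < 5], over Z_m the determinants are differences of absolute value
    at most 4, and 2, 3, 4 are units since [m] is prime to 6. *)
Lemma coprime6_incomplete (m h : nat) :
  1 < m -> coprime m 6 -> h <= m ->
  uniform_frame 4 (3 * #|Q|) -> uniform_frame 5 (3 * #|Q|) ->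
  incomplete m -> incomplete h -> incomplete (4 * m + h).
Proof.
move=> m1 co6; have cm : m = #|{: 'Z_m}| by rewrite card_ord Zp_cast.
rewrite [in X in X -> _]cm [X in _ -> _ -> _ -> incomplete X -> _]cm.
rewrite [X in _ -> _ -> _ -> _ -> _ -> incomplete (4 * X + _)]cm.
apply: (@transversal_incomplete _ (fun=> 1%R) (fun i => (val i)%:R%R)).
have unit_small (d : nat) : 0 < d < 5 -> (d%:R : 'Z_m)%R \is a GRing.unit.
  move=> d5; rewrite unitZpE //.
  have /andP[c2 c3] : coprime m 2 && coprime m 3 by rewrite -coprimeMr.
  have c4 : coprime m 4 by rewrite (coprimeMr m 2 2) c2.
  by case: d d5 => [|[|[|[|[|d]]]]] // _; rewrite ?coprimen1.
move=> i j ij; rewrite !GRing.mul1r.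
have [lt|lt|/val_inj eq_ij] := ltngtP (val i) (val j).
- rewrite -GRing.natrB 1?ltnW // unit_small // subn_gt0 lt /=; have := ltn_ord j; lia.
- rewrite -GRing.unitrN GRing.opprB -GRing.natrB 1?ltnW // unit_small //.
  by rewrite subn_gt0 lt /=; have := ltn_ord i; lia.
by rewrite eq_ij eqxx in ij.
Qed.

(** A field of order q has a projective line of [q + 1] points, five of which are needed; [None]
    encodes [(0 : 1)], and [Some x] encodes [(1 : x)]. This supplies the orders 4, 9 and 16. *)
Lemma field_incomplete (p k h : nat) : prime p -> 3 < p ^ k -> h <= p ^ k ->
  uniform_frame 4 (3 * #|Q|) -> uniform_frame 5 (3 * #|Q|) ->
  incomplete (p ^ k) -> incomplete h -> incomplete (4 * p ^ k + h).
Proof.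
move=> p_pr pk4.
have k0 : 0 < k by case: k pk4 => //; rewrite expn0.
have [F _ cF] := pPrimePowerField p_pr k0.
have F5 : 4 < #|{: option F}| by rewrite card_option ltnS cF.
rewrite -cF.
pose e (i : 'I_5) : option F := enum_val (widen_ord F5 i).
have e_inj : injective e by move=> i j /enum_val_inj /(congr1 val) /= /val_inj.
apply: (@transversal_incomplete F (fun i => if e i is Some _ then 1 else 0)%R
                                  (fun i => if e i is Some x then x else 1)%R) => i j ij.
rewrite GRing.unitfE; have : e i != e j by rewrite inj_eq.
case: (e i) => [x|]; case: (e j) => [y|] ne; rewrite ?eqxx // in ne *.
- by rewrite !GRing.mul1r GRing.subr_eq0 eq_sym; apply: contraNneq ne => ->.
- by rewrite GRing.mul0r GRing.mulr1 GRing.subr0 GRing.oner_eq0.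
by rewrite GRing.mul0r GRing.mulr1 GRing.sub0r GRing.oppr_eq0 GRing.oner_eq0.
Qed.

End TransversalClosure.

(** * The recursion *)

Definition develop (n : nat) (add : nat -> nat -> nat) (b : seq nat) : seq (seq nat) :=
  [seq [seq add x i | x <- b] | i <- iota 0 n].

Definition cyclic_blocks (n : nat) (b : seq nat) : seq (seq nat) :=
  develop n (fun x i => (x + i) %% n) b.

(** The four groups correspond to all four points of the projective line over F_3. *)
Definition td_4_3_blocks : seq (seq nat) :=
  [seq [:: x; 3 + y; 6 + (x + y) %% 3; 9 + (x + 2 * y) %% 3] | x <- iota 0 3, y <- iota 0 3].

Definition kts15_classes : seq (seq (seq nat)) :=
  [:: [:: [:: 0; 10; 13]; [:: 3; 7; 14]; [:: 1; 9; 12]; [:: 4; 6; 11]; [:: 2; 5; 8]];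
      [:: [:: 4; 7; 10]; [:: 2; 3; 12]; [:: 0; 5; 11]; [:: 8; 9; 13]; [:: 1; 6; 14]];
      [:: [:: 0; 7; 9]; [:: 4; 8; 12]; [:: 2; 11; 14]; [:: 5; 6; 13]; [:: 1; 3; 10]];
      [:: [:: 2; 7; 13]; [:: 0; 4; 14]; [:: 1; 8; 11]; [:: 3; 6; 9]; [:: 5; 10; 12]];
      [:: [:: 1; 4; 13]; [:: 7; 11; 12]; [:: 0; 3; 8]; [:: 5; 9; 14]; [:: 2; 6; 10]];
      [:: [:: 1; 5; 7]; [:: 2; 4; 9]; [:: 0; 6; 12]; [:: 8; 10; 14]; [:: 3; 11; 13]]].

(* Type 3^5 6^1: a new point is added to all triples of a parallel class. *)
Definition gdd_3_5_6_1_blocks : seq (seq nat) :=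
  flatten [seq [seq rcons b (15 + c) | b <- nth [::] kts15_classes c] | c <- iota 0 6].

(* Type 3^9, developed over Z_3 x Z_3 x Z_3. *)
Definition gdd_3_9_blocks : seq (seq nat) :=
  let add x i := 9 * ((x %/ 9 + i %/ 9) %% 3) + 3 * ((x %/ 3 + i %/ 3) %% 3)
                 + (x + i) %% 3 in
  develop 27 add [:: 0; 3; 9; 13] ++ develop 27 add [:: 0; 14; 16; 19].

(* Type 3^9 6^1, developed over Z_9 x Z_3, where [3 * a + b] stands for [(a, b)]; the
   points 27, 28, 29 and 30, 31, 32 are permuted by the translations. *)
Definition gdd_3_9_6_1_blocks : seq (seq nat) :=
  let add x i := if x < 27 then 3 * ((x %/ 3 + i %/ 3) %% 9) + (x + i) %% 3
                 else x + (i %/ 3) %% 3 in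
  develop 27 add [:: 0; 1; 3; 11] ++ develop 27 add [:: 0; 4; 15; 27]
  ++ develop 27 add [:: 0; 17; 23; 30].

Lemma td_4_3_gdd : gdd_table 4 12 3 (divn^~ 3) td_4_3_blocks.
Proof. by vm_compute. Qed.

(** The differences of 0, 1, 3, 7 modulo 15 are the residues not divisible by 5, each once. *)
Lemma gdd_3_5 : gdd_table 4 15 4 (modn^~ 5) (cyclic_blocks 15 [:: 0; 1; 3; 7]).
Proof. by vm_compute. Qed.

Lemma gdd_3_5_6_1 : gdd_table 4 21 5 (fun x => minn (x %/ 3) 5) gdd_3_5_6_1_blocks.
Proof. by vm_compute. Qed.

Lemma gdd_3_9 : gdd_table 4 27 8 (divn^~ 3) gdd_3_9_blocks.
Proof. by vm_compute. Qed.

Lemma gdd_3_9_6_1 :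
  gdd_table 4 33 9 (fun x => if x < 27 then x %% 9 else 9) gdd_3_9_6_1_blocks.
Proof. by vm_compute. Qed.

(** This is the projective plane of order 3, given by a perfect difference set. *)
Lemma gdd_1_13 : gdd_table 4 13 12 id (cyclic_blocks 13 [:: 0; 1; 3; 9]).
Proof. by vm_compute. Qed.

Lemma gdd_2_7 : gdd_table 4 14 6 (modn^~ 7) (cyclic_blocks 14 [:: 0; 1; 4; 6]).
Proof. by vm_compute. Qed.

Lemma uniform_frame4_mul3 (w : nat) : uniform_frame 4 w -> uniform_frame 4 (3 * w).
Proof.
move=> fr; apply: eq_frame (table_frame td_4_3_gdd fr) => j.
by congr (_ * _); case: j => [[|[|[|[|]]]]].
Qed.

(** The design of type 3^5 has five groups but blocks of size 4, so frames with five groups come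
    from those with four. *)
Lemma uniform_frame5_mul3 (w : nat) : uniform_frame 4 w -> uniform_frame 5 (3 * w).
Proof.
move=> fr; apply: eq_frame (table_frame gdd_3_5 fr) => j.
by congr (_ * _); case: j => [[|[|[|[|[|]]]]]].
Qed.

Section Spectrum.

Variables (W Q : finType) (L : Q -> nat) (fixed : bool).

Local Notation incomplete := (incomplete W L fixed).
Local Notation p := #|Q|.

Hypotheses (fr4 : uniform_frame 4 p) (fr4_2 : uniform_frame 4 (2 * p)).
Hypotheses (inc1 : incomplete 1) (inc2 : incomplete 2) (inc3 : incomplete 3).
Hypothesis inc6 : incomplete 6.

Lemma incomplete0 : incomplete 0.
Proof.
exists void, void, id, (fun (c : void) u => match c with end), (fun q y => y).
rewrite !card_void !muln0.
by split=> //; split=> // -[].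
Qed.

(** The bound 3 on the group parameters lets [incomplete0], [inc1], [inc2] and [inc3] fill every
    group. *)
Lemma table_step (n g w t : nat) (grp : nat -> nat) (bl : seq (seq nat)) :
  gdd_table 4 n g grp bl -> uniform_frame 4 (w * p) ->
  let c j := count (fun x => grp x == j) (iota 0 n) * w in
  all (fun j => (3 %| c j) && (c j %/ 3 <= 3)) (iota 0 g.+1) &&
  (sumn [seq c j %/ 3 | j <- iota 0 g.+1] == t) ->
  incomplete t.
Proof.
move=> tab fr c /andP[/allP sizes /eqP <-]; apply: (table_incomplete (k := 4) (bl := bl)) fr _.
  by rewrite tab; apply/allP => j /sizes /andP[].
move=> j /sizes /andP[_]; rewrite -/(c j).
by case: (c j %/ 3) => [|[|[|[|]]]] // _; apply: incomplete0.
Qed.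

Lemma incomplete_all (t : nat) : incomplete t.
Proof.
have fr4_3 := uniform_frame4_mul3 fr4.
have fr5_3 := uniform_frame5_mul3 fr4.
have fr4_6 : uniform_frame 4 (6 * p).
  have -> : 6 * p = 3 * (2 * p) by lia.
  exact: uniform_frame4_mul3.
have fr4_1 : uniform_frame 4 (1 * p) by rewrite mul1n.
elim/ltn_ind: t => t IH.
have trunc m h : 4 * m + h = t -> 0 < m -> h <= m -> incomplete m /\ incomplete h.
  by move=> e m0 hm; split; apply: IH; lia.
have by_coprime m : 4 * m <= t <= 5 * m -> 1 < m -> coprime m 6 -> incomplete t.
  move=> mt m1 co; have e : 4 * m + (t - 4 * m) = t by lia.
  have [//||im ih] := trunc _ _ e; [lia..|].
  by rewrite -e; apply: coprime6_incomplete => //; lia.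
have by_field q k : prime q -> 3 < q ^ k -> 4 * q ^ k <= t <= 5 * q ^ k -> incomplete t.
  move=> qP q3 qt; have e : 4 * q ^ k + (t - 4 * q ^ k) = t by lia.
  have [//||im ih] := trunc _ _ e; [lia..|].
  by rewrite -e; apply: field_incomplete => //; lia.
(* With [q = t %/ 4] and [m = q - d], the bound [t <= 4 * q + 3 <= 5 * m] holds once
   [q >= 5 * d + 3]. The descent [d] to a number prime to 6 is at most 3, and [q = 16], with
   [d = 3], is the last failure; hence [68 = 4 * 17]. *)
have [big|small] := leqP 68 t.
  (* the largest [m <= t / 4] prime to 6 *)
  have [d d3 dP] : exists2 d, 5 * d + 3 <= t %/ 4 & (t %/ 4 - d) %% 6 \in [:: 1; 5].
    have r6 : t %/ 4 %% 6 < 6 by rewrite ltn_mod.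
    exists (nth 0 [:: 1; 0; 1; 2; 3; 0] (t %/ 4 %% 6)).
      by case E: (t %/ 4 %% 6) r6 => [|[|[|[|[|[|]]]]]] // _ /=; lia.
    by case E: (t %/ 4 %% 6) r6 => [|[|[|[|[|[|]]]]]] // _; rewrite !inE /=; lia.
  apply: (by_coprime (t %/ 4 - d)); [lia..|].
  by rewrite -coprime_modl; move: dP; rewrite !inE => /orP[] /eqP ->.
have [t0|] := leqP t 15.
  (* The values 1, 2, 3, 6 are hypotheses and 0 is trivial; any other [t] comes from a table on [n]
     points with [n * w = 3 * t]. *)
  case: t {IH trunc by_coprime by_field small} t0 =>
    [|[|[|[|[|[|[|[|[|[|[|[|[|[|[|[|]]]]]]]]]]]]]]]] // _.
  - exact: incomplete0.
  - by apply: (table_step (w := 1) td_4_3_gdd).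
  - by apply: (table_step (w := 1) gdd_3_5).
  - by apply: (table_step (w := 1) gdd_3_5_6_1).
  - by apply: (table_step (w := 2) td_4_3_gdd).
  - by apply: (table_step (w := 1) gdd_3_9).
  - by apply: (table_step (w := 2) gdd_3_5).
  - by apply: (table_step (w := 1) gdd_3_9_6_1).
  - by apply: (table_step (w := 3) td_4_3_gdd).
  - by apply: (table_step (w := 3) gdd_1_13).
  - by apply: (table_step (w := 3) gdd_2_7).
  - by apply: (table_step (w := 3) gdd_3_5).
move=> t15.
have [|n20] := boolP (16 <= t <= 20); first by move=> tI; apply: (by_field 2 2) => //; lia.
have [|n25] := boolP (20 <= t <= 25); first by move=> tI; apply: (by_coprime 5) => //; lia.
(* For 26 and 27 truncation would require [m = 6], which is neither prime to 6 nor a prime power. *)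
have [e|n26] := eqVneq t 26; first by apply: (table_step (w := 6) gdd_1_13); rewrite ?e.
have [e|n27] := eqVneq t 27; first by apply: (table_step (w := 3) gdd_3_9); rewrite ?e.
have [|n35] := boolP (28 <= t <= 35); first by move=> tI; apply: (by_coprime 7) => //; lia.
have [|n45] := boolP (36 <= t <= 45); first by move=> tI; apply: (by_field 3 2) => //; lia.
have [|n55] := boolP (44 <= t <= 55); first by move=> tI; apply: (by_coprime 11) => //; lia.
have [|n65] := boolP (52 <= t <= 65); first by move=> tI; apply: (by_coprime 13) => //; lia.
(* Only 66 and 67 are left, reached with [m = 16]. *)
apply: (by_field 2 4) => //; lia.
Qed.

End Spectrum.

(** * Explicit designs *)

(** A point on none of the cycles is fixed, since [next] of the default empty block is the identity;
    so the empty list encodes the identity map. *)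
Definition rot_cycles (cs : seq (seq nat)) (x : nat) : nat :=
  next (nth [::] cs (find (fun b => x \in b) cs)) x.

Definition joined_in (tb : seq nat) (x z : nat) : bool :=
  (nth 0 tb x == z) || (nth 0 tb z == x).

(* The points of the hole are [n, ..., n + m - 1], and [phi] lists the pairs of the
   1-factor as cycles of length 2. *)
Definition incomplete_table (n m : nat) (fixed : bool) (lens : seq nat)
    (phi : seq (seq nat)) (part full : seq (seq (seq nat))) : bool :=
  let ph := rot_cycles phi in
  let full_tb := [seq [seq rot_cycles c x | x <- iota 0 (n + m)] | c <- full] in
  let part_tb := [seq [seq rot_cycles c x | x <- iota 0 n] | c <- part] in
  [&& all (fun x => [&& ph x < n, ph (ph x) == x & (ph x == x) == fixed]) (iota 0 n),
      all (fun tb => all (fun x => let y := nth 0 tb x in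
          [&& y < n + m, nth 0 tb (nth 0 tb y) == x
            & if x < n then (y < n) ==> (y != x) && (y != ph x) else y < n])
        (iota 0 (n + m))) full_tb,
      all (fun q => all (fun x => let r := nth 0 (nth [::] part_tb q) in
          [&& r x < n, iter (nth 0 lens q) r x == x,
              all (fun i => iter i r x != x) (iota 1 (nth 0 lens q).-1) & r x != ph x])
        (iota 0 n)) (iota 0 (size lens)),
      all (fun x => all (fun z => [|| z == x, z == ph x,
          has (fun tb => joined_in tb x z) full_tb
          | has (fun q => joined_in (nth [::] part_tb q) x z) (iota 0 (size lens))])
        (iota 0 n)) (iota 0 n)
    & all (fun x => all (fun w => has (fun tb => joined_in tb x w) full_tb) (iota n m))
        (iota 0 n)].

(** By cardinality [code] is onto the numbers below [n], so a map on codes pulls back to [P]. *)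
Lemma coded_map (P : finType) (n : nat) (code : P -> nat) (r : nat -> nat) :
  injective code -> (forall x, code x < n) -> #|P| = n ->
  (forall i, i < n -> r i < n) ->
  exists f : P -> P, forall x, code (f x) = r (code x).
Proof.
move=> code_inj code_lt cP r_lt.
pose c x : 'I_n := Ordinal (code_lt x).
have c_inj : injective c by move=> x y /(congr1 val) /code_inj.
have [|g cK gK] := inj_card_bij c_inj; first by rewrite card_ord cP.
exists (fun x => g (Ordinal (r_lt _ (code_lt x)))) => x.
by rewrite -[LHS]/(val (c _)) gK.
Qed.

Lemma table_incomplete_on (n m : nat) (fixed : bool) (lens : seq nat)
    (phi : seq (seq nat)) (part full : seq (seq (seq nat))) :
  incomplete_table n m fixed lens phi part full ->
  exists (ph : 'I_n -> 'I_n) (f : 'I_(size full) -> 'I_n + 'I_m -> 'I_n + 'I_m)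
         (h : 'I_(size lens) -> 'I_n -> 'I_n),
    incomplete_on (fun q : 'I_(size lens) => nth 0 lens q) fixed predT predT ph f h /\
    forall y, val (ph y) = rot_cycles phi (val y).
Proof.
rewrite /incomplete_table; set r := rot_cycles phi.
set full_tb := [seq _ | c <- full]; set part_tb := [seq _ | c <- part].
case/and5P=> /allP P1 /allP P2 /allP P3 /allP P4 /allP P5.
pose code (u : 'I_n + 'I_m) : nat := match u with inl y => y | inr w => n + w end.
have code_lt u : code u < n + m.
  by case: u => [y|w] /=; [have := ltn_ord y | have := ltn_ord w]; lia.
have code_inj : injective code.
  by move=> [y|w] [y'|w'] /=; [|have := ltn_ord y|have := ltn_ord y'|];
     try lia; move=> e; congr (_ _); apply: val_inj => /=; lia.
have inY (y : 'I_n) : val y \in iota 0 n by rewrite mem_iota add0n /=.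
have inP u : code u \in iota 0 (n + m) by rewrite mem_iota add0n /=.
have inQ (q : 'I_(size lens)) : val q \in iota 0 (size lens) by rewrite mem_iota add0n /=.
have [||||ph phE] := @coded_map 'I_n n val r; [exact: val_inj | exact: ltn_ord
  | exact: card_ord | by move=> i i_lt; have /and3P[] := P1 i (ltac:(by rewrite mem_iota)) |].
pose ft (c : 'I_(size full)) := nth [::] full_tb c.
have ftP (c : 'I_(size full)) : ft c \in full_tb by rewrite mem_nth // size_map.
have /fin_all_exists[f fE] c : exists f, forall u, code (f u) = nth 0 (ft c) (code u).
  apply: (@coded_map _ (n + m)) => // [|i i_lt]; first by rewrite card_sum !card_ord.
  by have /allP/(_ i) := P2 _ (ftP c); rewrite mem_iota => /(_ i_lt) /and3P[].
pose pt (q : 'I_(size lens)) := nth [::] part_tb q.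
have /fin_all_exists[h hE] q : exists h : 'I_n -> 'I_n, forall y, val (h y) = nth 0 (pt q) (val y).
  apply: (@coded_map _ n) => [|x||i i_lt];
    [exact: val_inj | exact: ltn_ord | exact: card_ord |].
  by have /allP/(_ i) := P3 _ (inQ q); rewrite mem_iota => /(_ i_lt) /and4P[].
have fulljoin x z : has (fun tb => joined_in tb (code x) (code z)) full_tb ->
    exists2 c, predT c & joined (f c) x z.
  case/(has_nthP [::])=> i; rewrite size_map => i_lt j.
  by exists (Ordinal i_lt); rewrite // /joined -!(inj_eq code_inj) !fE.
exists ph, f, h; split=> //; split.
- move=> y _; have /and3P[_ /eqP e1 /eqP e2] := P1 _ (inY y).
  by split=> //; [apply: val_inj | rewrite -val_eqE]; rewrite /= !phE.
- move=> c u _ _; have /allP/(_ _ (inP u)) := P2 _ (ftP c).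
  rewrite -!fE => /and3P[_ /eqP/code_inj e al]; split=> //; first by case: (f c u).
  case: u al {e} => [y|w] /=; rewrite ?ltn_ord.
    by case: (f c _) => //= z; rewrite ltn_ord -phE.
  by rewrite [n + w < n]ltnNge leq_addr; case: (f c _) => //= z; rewrite ltnNge leq_addr.
- move=> q y _; have /allP/(_ _ (inY y)) := P3 _ (inQ q).
  have itE i : val (iter i (h q) y) = iter i (nth 0 (pt q)) (val y).
    by elim: i => //= i <-; rewrite hE.
  case/and4P=> _ /eqP e1 /allP e2 _; split=> //; first by apply: val_inj; rewrite itE.
  move=> i i_lt /(congr1 val); rewrite itE => /eqP; apply/negP/e2.
  by move: i_lt; rewrite mem_iota /=; lia.
- move=> q y _; have /allP/(_ _ (inY y)) := P3 _ (inQ q).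
  by case/and4P=> _ _ _; rewrite -val_eqE /= hE phE.
- move=> y z _ _ n1 n2; have /allP/(_ _ (inY z)) := P4 _ (inY y).
  rewrite -phE !(val_eqE (z : 'I_n)) (negbTE n1) (negbTE n2) /= => /orP[j | /hasP[q]].
    by left; apply: (fulljoin (inl y) (inl z)).
  rewrite mem_iota add0n => q_lt j; right; exists (Ordinal q_lt).
  by rewrite /joined -!val_eqE /= !hE.
- move=> y w _; apply: fulljoin => /=.
  have /allP := P5 _ (inY y); apply; rewrite mem_iota.
  by have := ltn_ord w; lia.
Qed.

Lemma table_incomplete_design (n m t : nat) (fixed : bool) (lens : seq nat)
    (phi : seq (seq nat)) (part full : seq (seq (seq nat))) :
  incomplete_table n m fixed lens phi part full ->
  n = 6 * size lens * t -> size full = 3 * size lens * t ->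
  incomplete 'I_m (fun q : 'I_(size lens) => nth 0 lens q) fixed t.
Proof.
case/table_incomplete_on=> ph [f [h [P _]]] nE fE.
by exists 'I_n, 'I_(size full), ph, f, h; rewrite !card_ord.
Qed.

(* Points [2 * w * i + x] stand for [(i, x)] in {0, 1, 2, 3} x Z_2w.  Class [c] misses
   group [c %/ w] and is one orbit of triples under Z_2w, the first of which has second
   coordinates 0 and the two listed offsets. *)
Definition offset_classes (w : nat) (offs : seq (nat * nat)) : seq (seq (seq nat)) :=
  [seq let g := [seq 2 * w * i | i <- iota 0 4 & i != c %/ w] in
       [seq [:: nth 0 g 0 + x; nth 0 g 1 + (x + (nth (0, 0) offs c).1) %% (2 * w);
                nth 0 g 2 + (x + (nth (0, 0) offs c).2) %% (2 * w)] | x <- iota 0 (2 * w)]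
  | c <- iota 0 (4 * w)].

Definition frame4_table (w : nat) (offs : seq (nat * nat)) : bool :=
  let tbs := [seq [seq rot_cycles c x | x <- iota 0 (8 * w)] | c <- offset_classes w offs] in
  all (fun c => all (fun x => (x %/ (2 * w) == c %/ w) ||
      let r := nth 0 (nth [::] tbs c) in
      [&& r x < 8 * w, r x %/ (2 * w) != c %/ w, r x %/ (2 * w) != x %/ (2 * w)
        & r (r (r x)) == x]) (iota 0 (8 * w))) (iota 0 (4 * w)) &&
  all (fun x => all (fun z => (x %/ (2 * w) == z %/ (2 * w)) ||
      has (fun c => [&& c %/ w != x %/ (2 * w), c %/ w != z %/ (2 * w)
                      & joined_in (nth [::] tbs c) x z]) (iota 0 (4 * w)))
    (iota 0 (8 * w))) (iota 0 (8 * w)).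

(** The widths 1, 2, 4 are the values [p] and [2 * p] for [p = 1] (triple systems) and [p = 2]
    (octahedra). Between any two groups, the [2 * w] classes missing neither realise each difference
    in Z_2w once. *)
Definition offsets1 := [:: (1, 1); (1, 0); (1, 1); (0, 0)].
Definition offsets2 := [:: (2, 0); (1, 1); (0, 3); (3, 0); (2, 1); (0, 2); (3, 2); (1, 1)].
Definition offsets4 :=
  [:: (0, 5); (3, 6); (5, 7); (2, 2); (4, 2); (3, 7); (7, 6); (2, 3);
      (6, 1); (4, 0); (3, 4); (5, 5); (1, 5); (2, 0); (0, 1); (7, 6)].

Lemma frame4_table1 : frame4_table 1 offsets1. Proof. by vm_compute. Qed.
Lemma frame4_table2 : frame4_table 2 offsets2. Proof. by vm_compute. Qed.
Lemma frame4_table4 : frame4_table 4 offsets4. Proof. by vm_compute. Qed.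

Lemma card_fst_fiber (I J : finType) (i : I) : #|[pred x : I * J | x.1 == i]| = #|J|.
Proof.
rewrite -(card_image (f := fun y : J => (i, y))) => [|y z [] //].
apply: eq_card => -[i' y]; rewrite inE; apply/eqP/imageP => /= [->|[z _ [-> _]] //].
by exists y.
Qed.

Lemma frame4_of_table (w : nat) (offs : seq (nat * nat)) :
  frame4_table w offs -> uniform_frame 4 w.
Proof.
rewrite /frame4_table; set tbs := [seq _ | c <- _].
case/andP=> /allP P1 /allP P2.
pose code k (x : 'I_4 * 'I_k) := x.1 * k + x.2.
have code_div k x : @code k x %/ k = x.1.
  have k0 : 0 < k := leq_ltn_trans (leq0n _) (ltn_ord x.2).
  by rewrite /code divnMDl // divn_small ?addn0.
have code_lt k x : @code k x < 4 * k.
  by case: x => [[i i4] [a ak]]; rewrite /code /=; nia.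
have code_inj k : injective (@code k).
  move=> x y e; have e1 : nat_of_ord x.1 = y.1 by rewrite -!code_div e.
  move: e; rewrite /code e1 => /addnI e2; case: x y e1 e2 => [x1 x2] [y1 y2] /=.
  by move=> /val_inj -> /val_inj ->.
have inC x : code w x \in iota 0 (4 * w) by rewrite mem_iota add0n code_lt.
have inY x : code (2 * w) x \in iota 0 (8 * w).
  by rewrite mem_iota add0n; have := code_lt _ x; lia.
have eq1 (i j : 'I_4) : (val i == val j) = (i == j) by [].
pose tb c := nth 0 (nth [::] tbs (code w c)).
have /fin_all_exists[f fE] c : exists f : 'I_4 * 'I_(2 * w) -> 'I_4 * 'I_(2 * w),
    forall y, y.1 != c.1 -> code _ (f y) = tb c (code _ y).
  (* The table is checked only off the missed group; the identity there keeps [r] below [8 * w]. *)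
  pose r x := if x %/ (2 * w) == c.1 then x else tb c x.
  have [||||f fP] := @coded_map ('I_4 * 'I_(2 * w))%type (8 * w) (@code _) r.
  - exact: code_inj.
  - by move=> x; have := code_lt _ x; lia.
  - by rewrite card_prod !card_ord; lia.
  - move=> i i_lt; rewrite /r; case: ifPn => // ne.
    have /allP/(_ i) := P1 _ (inC c); rewrite mem_iota i_lt code_div (negbTE ne).
    by move=> /(_ isT)/and4P[].
  by exists f => y ne; rewrite fP /r code_div eq1 (negbTE ne).
exists ('I_4 * 'I_(2 * w))%type, ('I_4 * 'I_w)%type, fst, fst, f; split.
- by move=> j; rewrite card_fst_fiber card_ord.
- by move=> j; rewrite card_fst_fiber card_ord.
split=> [c y _ _ ne | y z _ _ ne].
  have step x : x.1 != c.1 -> [/\ (f c x).1 != c.1, (f c x).1 != x.1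
      & tb c (tb c (code _ (f c x))) = code _ x].
    move=> nx; have /allP/(_ _ (inY x)) := P1 _ (inC c); rewrite !code_div eq1 (negbTE nx) /=.
    by rewrite -/(tb c) -fE // !code_div => /and4P[_ n1 n2 /eqP e].
  have [n1 n2 e] := step y ne; have [n3 _ _] := step _ n1.
  by split=> //; apply: code_inj; rewrite !fE // -[in LHS]fE.
have /allP/(_ _ (inY z)) := P2 _ (inY y); rewrite !code_div eq1 (negbTE ne) /=.
case/hasP=> c; rewrite mem_iota add0n => /= c_lt /and3P[c1 c2 j].
have w0 : 0 < w by case: (w) c_lt; rewrite ?muln0.
have q4 : c %/ w < 4 by rewrite ltn_divLR.
pose d : 'I_4 * 'I_w := (Ordinal q4, Ordinal (ltn_pmod c w0)).
have dE : code w d = c by rewrite /code /= -divn_eq.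
exists d; split=> //.
move: j; rewrite /joined_in -dE -/(tb d) -!fE //; try by rewrite eq_sym.
by case/orP=> /eqP /code_inj; [left | right].
Qed.

(* Points [k * j + i] stand for [(j, i)] in Z_y x {0, ..., k - 1}.  A class in [free]
   has [y] translates, whereas [fixed] lists orbit representatives of classes that are
   invariant under Z_y. *)
Definition rgdd_classes (k y : nat) (free fixed : seq (seq (seq nat))) : seq (seq (seq nat)) :=
  let shift d := map (map (fun x => (x + k * d) %% (k * y))) in
  [seq shift d c | c <- free, d <- iota 0 y] ++
  [seq flatten [seq shift d c | d <- iota 0 y] | c <- fixed].

Definition on_groups (k n : nat) (c : seq (seq nat)) : seq (seq nat) :=
  flatten [seq map (map (addn (k * j))) c | j <- iota 0 n].

(* The vertices [i] and [i + 3] are opposite. *)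
Definition octahedron_phi : seq (seq nat) := [:: [:: 0; 3]; [:: 1; 4]; [:: 2; 5]].

Definition octahedron_36 : seq (seq (seq nat)) :=
  [:: [:: [:: 0; 1; 2]; [:: 3; 4; 5]]; [:: [:: 0; 4; 2; 3; 1; 5]]].

Definition octahedron_66 : seq (seq (seq nat)) :=
  [:: [:: [:: 0; 1; 3; 2; 4; 5]]; [:: [:: 4; 0; 2; 1; 5; 3]]].

(** These are the lines of slope [m] in the affine plane of order 3; the fourth parallel class
    consists of the groups. *)
Definition kts9_classes : seq (seq (seq nat)) :=
  [seq [seq [:: i; 3 + (i + m) %% 3; 6 + (i + 2 * m) %% 3] | i <- iota 0 3] | m <- iota 0 3].

Definition rgdd_3_7_free : seq (seq (seq nat)) :=
    [:: [:: [:: 0; 5; 16]; [:: 1; 8; 15]; [:: 2; 3; 7]; [:: 4; 6; 17]; [:: 9; 12; 18];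
    [:: 10; 13; 19]; [:: 11; 14; 20]]].

Definition rgdd_3_7_fixed : seq (seq (seq nat)) :=
    [:: [:: [:: 0; 13; 17]]; [:: [:: 0; 10; 8]]].

Definition rgdd_3_13_free : seq (seq (seq nat)) :=
    [:: [:: [:: 0; 7; 18]; [:: 1; 16; 20]; [:: 2; 8; 15]; [:: 3; 28; 33]; [:: 4; 34; 37];
    [:: 5; 10; 22]; [:: 6; 17; 19]; [:: 9; 26; 29]; [:: 11; 23; 32]; [:: 12; 24; 27];
    [:: 13; 21; 31]; [:: 14; 25; 38]; [:: 30; 35; 36]]].

Definition rgdd_3_13_fixed : seq (seq (seq nat)) :=
    [:: [:: [:: 0; 37; 23]]; [:: [:: 0; 16; 8]]; [:: [:: 0; 22; 29]]; [:: [:: 0; 19; 35]];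
    [:: [:: 0; 4; 14]]].

Definition rgdd_6_5_free : seq (seq (seq nat)) :=
    [:: [:: [:: 0; 19; 26]; [:: 1; 15; 27]; [:: 2; 14; 28]; [:: 3; 11; 20]; [:: 4; 12; 24];
    [:: 5; 7; 25]; [:: 6; 17; 23]; [:: 8; 13; 18]; [:: 9; 22; 29]; [:: 10; 16; 21]];
    [:: [:: 0; 6; 13]; [:: 1; 22; 25]; [:: 2; 11; 19]; [:: 3; 18; 26]; [:: 4; 17; 29];
    [:: 5; 8; 16]; [:: 7; 23; 27]; [:: 9; 14; 20]; [:: 10; 12; 28]; [:: 15; 21; 24]]].

Definition rgdd_6_5_fixed : seq (seq (seq nat)) :=
    [:: [:: [:: 0; 9; 23]; [:: 1; 20; 10]]; [:: [:: 0; 14; 29]; [:: 1; 9; 16]]].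

Definition rgdd_6_7_free : seq (seq (seq nat)) :=
    [:: [:: [:: 0; 6; 15]; [:: 1; 13; 28]; [:: 2; 11; 26]; [:: 3; 7; 31]; [:: 4; 14; 20];
    [:: 5; 24; 36]; [:: 8; 27; 33]; [:: 9; 18; 34]; [:: 10; 12; 22]; [:: 16; 23; 37];
    [:: 17; 25; 41]; [:: 19; 30; 38]; [:: 21; 35; 40]; [:: 29; 32; 39]]; [:: [:: 0; 18; 39];
    [:: 1; 34; 37]; [:: 2; 23; 32]; [:: 3; 11; 33]; [:: 4; 15; 22]; [:: 5; 28; 41]; [:: 6;
    13; 26]; [:: 7; 14; 24]; [:: 8; 21; 36]; [:: 9; 19; 27]; [:: 10; 16; 38]; [:: 12; 31;
    40]; [:: 17; 29; 30]; [:: 20; 25; 35]]].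

Definition rgdd_6_7_fixed : seq (seq (seq nat)) :=
    [:: [:: [:: 0; 26; 22]; [:: 1; 27; 23]]; [:: [:: 0; 37; 35]; [:: 2; 39; 10]]; [:: [:: 0;
    34; 17]; [:: 1; 32; 21]]; [:: [:: 0; 13; 38]; [:: 3; 40; 29]]].

Definition rgdd_6_13_free : seq (seq (seq nat)) :=
    [:: [:: [:: 0; 52; 57]; [:: 1; 10; 71]; [:: 2; 23; 45]; [:: 3; 34; 72]; [:: 4; 17; 61];
    [:: 5; 26; 39]; [:: 6; 21; 69]; [:: 7; 44; 76]; [:: 8; 15; 64]; [:: 9; 70; 73]; [:: 11;
    53; 56]; [:: 12; 32; 37]; [:: 13; 36; 77]; [:: 14; 28; 30]; [:: 16; 43; 49]; [:: 18; 29;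
    40]; [:: 19; 46; 58]; [:: 20; 48; 65]; [:: 22; 47; 62]; [:: 24; 51; 59]; [:: 25; 60;
    74]; [:: 27; 54; 67]; [:: 31; 38; 63]; [:: 33; 42; 66]; [:: 35; 55; 75]; [:: 41; 50;
    68]]; [:: [:: 0; 10; 72]; [:: 1; 23; 61]; [:: 2; 26; 57]; [:: 3; 31; 46]; [:: 4; 14;
    53]; [:: 5; 36; 69]; [:: 6; 32; 38]; [:: 7; 43; 55]; [:: 8; 20; 50]; [:: 9; 29; 45];
    [:: 11; 70; 74]; [:: 12; 19; 30]; [:: 13; 37; 56]; [:: 15; 27; 33]; [:: 16; 40; 76];
    [:: 17; 68; 77]; [:: 18; 54; 66]; [:: 21; 47; 60]; [:: 22; 52; 75]; [:: 24; 62; 73];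
    [:: 25; 51; 58]; [:: 28; 34; 49]; [:: 35; 41; 65]; [:: 39; 42; 63]; [:: 44; 48; 67];
    [:: 59; 64; 71]]].

Definition rgdd_6_13_fixed : seq (seq (seq nat)) :=
    [:: [:: [:: 0; 64; 29]; [:: 1; 32; 69]]; [:: [:: 0; 68; 34]; [:: 1; 75; 29]]; [:: [:: 0;
    37; 53]; [:: 2; 75; 64]]; [:: [:: 0; 8; 58]; [:: 1; 9; 77]]; [:: [:: 0; 61; 71]; [:: 2;
    63; 22]]; [:: [:: 0; 28; 59]; [:: 1; 26; 45]]; [:: [:: 0; 46; 23]; [:: 1; 14; 63]];
    [:: [:: 0; 44; 70]; [:: 1; 57; 53]]; [:: [:: 0; 31; 77]; [:: 2; 69; 10]]; [:: [:: 0; 73;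
    56]; [:: 3; 16; 53]]].

(* There is no resolvable design of type 6^3, so for [t = 1] the pairs left over by the
   full classes do not form octahedra, and (3, 6) and (6, 6) need separate designs. *)
Definition hwp18_36_phi : seq (seq nat) :=
    [:: [:: 0; 2]; [:: 1; 3]; [:: 4; 5]; [:: 6; 7]; [:: 8; 11]; [:: 9; 10]].

Definition hwp18_36_part : seq (seq (seq nat)) :=
    [:: [:: [:: 0; 7; 9]; [:: 1; 6; 8]; [:: 10; 2; 5]; [:: 11; 3; 4]]; [:: [:: 0; 1; 4; 2;
    3; 5]; [:: 6; 9; 8; 7; 11; 10]]].

Definition hwp18_36_full : seq (seq (seq nat)) :=
    [:: [:: [:: 0; 8; 16]; [:: 1; 9; 17]; [:: 2; 11; 14]; [:: 3; 10; 15]; [:: 4; 7; 13];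
    [:: 5; 6; 12]]; [:: [:: 0; 11; 13]; [:: 1; 10; 12]; [:: 2; 7; 17]; [:: 3; 6; 16]; [:: 4;
    8; 15]; [:: 5; 9; 14]]; [:: [:: 0; 6; 15]; [:: 1; 7; 14]; [:: 2; 8; 12]; [:: 3; 9; 13];
    [:: 4; 10; 17]; [:: 5; 11; 16]]; [:: [:: 0; 3; 17]; [:: 1; 2; 16]; [:: 4; 6; 14]; [:: 5;
    7; 15]; [:: 8; 10; 13]; [:: 9; 11; 12]]; [:: [:: 0; 10; 14]; [:: 1; 11; 15]; [:: 2; 6;
    13]; [:: 3; 7; 12]; [:: 4; 9; 16]; [:: 5; 8; 17]]; [:: [:: 0; 4; 12]; [:: 1; 5; 13];
    [:: 2; 9; 15]; [:: 3; 8; 14]; [:: 6; 11; 17]; [:: 7; 10; 16]]].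

Definition hwp18_66_phi : seq (seq nat) :=
    [:: [:: 0; 3]; [:: 1; 2]; [:: 4; 11]; [:: 5; 10]; [:: 6; 9]; [:: 7; 8]].

Definition hwp18_66_part : seq (seq (seq nat)) :=
    [:: [:: [:: 0; 5; 4; 1; 10; 11]; [:: 2; 6; 8; 3; 7; 9]]; [:: [:: 0; 1; 11; 2; 3; 10];
    [:: 4; 7; 6; 5; 8; 9]]].

Definition hwp18_66_full : seq (seq (seq nat)) :=
    [:: [:: [:: 0; 2; 13]; [:: 1; 3; 12]; [:: 4; 8; 15]; [:: 5; 9; 14]; [:: 6; 10; 16];
    [:: 7; 11; 17]]; [:: [:: 0; 9; 17]; [:: 1; 8; 16]; [:: 2; 10; 14]; [:: 3; 11; 15];
    [:: 4; 6; 12]; [:: 5; 7; 13]]; [:: [:: 0; 6; 15]; [:: 1; 7; 14]; [:: 2; 4; 17]; [:: 3;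
    5; 16]; [:: 8; 11; 13]; [:: 9; 10; 12]]; [:: [:: 0; 4; 16]; [:: 1; 5; 17]; [:: 2; 8;
    12]; [:: 3; 9; 13]; [:: 6; 11; 14]; [:: 7; 10; 15]]; [:: [:: 0; 8; 14]; [:: 1; 9; 15];
    [:: 2; 7; 16]; [:: 3; 6; 17]; [:: 4; 10; 13]; [:: 5; 11; 12]]; [:: [:: 0; 7; 12]; [:: 1;
    6; 13]; [:: 2; 5; 15]; [:: 3; 4; 14]; [:: 8; 10; 17]; [:: 9; 11; 16]]].


(** * Kirkman triple systems with a block as hole *)

Definition triple_incomplete (t : nat) : Prop :=
  incomplete 'I_3 (fun q : 'I_1 => nth 0 [:: 3] q) true t.

(** One parallel class is singled out: its last triple is the hole, its other triples form the
    partial class. *)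
Lemma triple_incomplete_of_table (t : nat) (full : seq (seq (seq nat))) :
  incomplete_table (6 * t) 3 true [:: 3] [::] [:: on_groups 3 (2 * t) [:: [:: 0; 1; 2]]] full ->
  size full = 3 * t -> triple_incomplete t.
Proof. by move=> tab sz; apply: table_incomplete_design tab _ _. Qed.

Lemma triple_incomplete_all (t : nat) : triple_incomplete t.
Proof.
apply: incomplete_all; rewrite ?card_ord.
- exact: frame4_of_table frame4_table1.
- exact: frame4_of_table frame4_table2.
- by apply: (@triple_incomplete_of_table 1 kts9_classes); vm_compute.
- by apply: (@triple_incomplete_of_table 2 kts15_classes); vm_compute.
- by apply: (@triple_incomplete_of_table 3 (rgdd_classes 3 7 rgdd_3_7_free rgdd_3_7_fixed));
    vm_compute.
- by apply: (@triple_incomplete_of_table 6 (rgdd_classes 3 13 rgdd_3_13_free rgdd_3_13_fixed));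
    vm_compute.
Qed.

(** * Designs with a hole of six points *)

Definition octahedral_incomplete (lens : seq nat) (t : nat) : Prop :=
  incomplete 'I_6 (fun q : 'I_(size lens) => nth 0 lens q) false t.

(** In a resolvable design of type 6^(2t+1) the last group is the hole, and every other group
    carries an octahedron split as in [oct]. *)
Definition rgdd_6_incomplete_table (lens : seq nat) (oct : seq (seq (seq nat)))
    (t : nat) (full : seq (seq (seq nat))) : bool :=
  incomplete_table (12 * t) 6 false lens (on_groups 6 (2 * t) octahedron_phi)
    [seq on_groups 6 (2 * t) c | c <- oct] full.

Lemma octahedral_incomplete_of_table (lens : seq nat) (oct : seq (seq (seq nat))) (t : nat)
    (full : seq (seq (seq nat))) :
  rgdd_6_incomplete_table lens oct t full -> size lens = 2 -> size full = 6 * t ->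
  octahedral_incomplete lens t.
Proof. by move=> tab sz2 sz; apply: table_incomplete_design tab _ _; rewrite ?sz sz2; lia. Qed.

Section Octahedral.

Variables (lens : seq nat) (oct : seq (seq (seq nat))).

Let full5 := rgdd_classes 6 5 rgdd_6_5_free rgdd_6_5_fixed.
Let full7 := rgdd_classes 6 7 rgdd_6_7_free rgdd_6_7_fixed.
Let full13 := rgdd_classes 6 13 rgdd_6_13_free rgdd_6_13_fixed.

Lemma octahedral_incomplete_all : size lens = 2 -> octahedral_incomplete lens 1 ->
  [&& rgdd_6_incomplete_table lens oct 2 full5,
      rgdd_6_incomplete_table lens oct 3 full7
    & rgdd_6_incomplete_table lens oct 6 full13] ->
  forall t, octahedral_incomplete lens t.
Proof.
move=> sz2 inc1 /and3P[t2 t3 t6]; apply: incomplete_all.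
- by rewrite card_ord sz2; apply: frame4_of_table frame4_table2.
- by rewrite card_ord sz2; apply: frame4_of_table frame4_table4.
- exact: inc1.
- by apply: octahedral_incomplete_of_table t2 _ _ => //; vm_compute.
- by apply: octahedral_incomplete_of_table t3 _ _ => //; vm_compute.
- by apply: octahedral_incomplete_of_table t6 _ _ => //; vm_compute.
Qed.

End Octahedral.

Lemma octahedral_incomplete_36 (t : nat) : octahedral_incomplete [:: 3; 6] t.
Proof.
apply: (@octahedral_incomplete_all _ octahedron_36); [by [] | | by vm_compute].
have tab : incomplete_table 12 6 false [:: 3; 6] hwp18_36_phi hwp18_36_part hwp18_36_full.
  by vm_compute.
exact: table_incomplete_design tab _ _.
Qed.

Lemma octahedral_incomplete_66 (t : nat) : octahedral_incomplete [:: 6; 6] t.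
Proof.
apply: (@octahedral_incomplete_all _ octahedron_66); [by [] | | by vm_compute].
have tab : incomplete_table 12 6 false [:: 6; 6] hwp18_66_phi hwp18_66_part hwp18_66_full.
  by vm_compute.
exact: table_incomplete_design tab _ _.
Qed.

(** * From classes to the Hamilton-Waterloo problem *)

Record factorization (T : eqType) (I : Type) (L : I -> nat) (fixed : bool) (phi : T -> T)
    (h : I -> T -> T) : Prop := Factorization {
  fac_phi : forall x, phi (phi x) = x;
  fac_fixed : forall x, (phi x == x) = fixed;
  fac_cycles : forall i, cycles_of_length predT (L i) (h i);
  fac_phiN : forall i x, h i x != phi x;
  fac_cover : forall x y, y != x -> y != phi x -> exists i, joined (h i) x y
}.

Lemma joined_sym (T : eqType) (f : T -> T) (x y : T) : joined f x y = joined f y x.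
Proof. exact: orbC. Qed.

Lemma cycles3 (T : eqType) (f : T -> T) :
  (forall x, f (f (f x)) = x) -> (forall x, f x != x) -> cycles_of_length predT 3 f.
Proof.
move=> f3 fN x _; split=> // [|[|[|[|i]]] // _ /eqP]; first exact: f3; apply/negP => //=.
by apply: contraNneq (fN x) => e; rewrite -[X in _ == X](f3 x) /= e.
Qed.

(** Each partial class on [Y] is completed by a class of the hole with the same index in [Q], hence
    the same cycle length. *)
Lemma incomplete_complete (W Y C Q : finType) (L : Q -> nat) (fixed : bool)
    (phi : Y -> Y) (f : C -> Y + W -> Y + W) (h : Q -> Y -> Y)
    (phiW : W -> W) (hW : Q -> W -> W) :
  incomplete_on L fixed predT predT phi f h -> factorization L fixed phiW hW ->
  factorization (fun i : C + Q => if i is inr q then L q else 3) fixed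
    (fun u : Y + W => match u with inl y => inl (phi y) | inr w => inr (phiW w) end)
    (fun (i : C + Q) u => match i with
       | inl c => f c u
       | inr q => match u with inl y => inl (h q y) | inr w => inr (hW q w) end end).
Proof.
case=> P1 P2 P3 P4 P5 P6 [R1 R2 R3 R4 R5].
have outerT (u : Y + W) : outer (@predT Y) u by case: u.
split.
- by case=> [y|w]; [have [_ ->] := P1 y isT | rewrite R1].
- by case=> [y|w]; [have [_ _ <-] := P1 y isT | rewrite -(R2 w)].
- case=> [c|q].
    apply: cycles3 => u; have [_ e al] := P2 c u isT (outerT u) => //.
    by apply: contraTneq al => ->; case: u {e} => //= y; rewrite eqxx.
  have itE n u : iter n (fun u => match u with inl y => inl (h q y) | inr w => inr (hW q w) end) u =
      match u with inl y => inl (iter n (h q) y) | inr w => inr (iter n (hW q) w) end.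
    by elim: n => [|n /= ->]; case: u.
  case=> [y|w] _; [have [_ e n] := P3 q y isT | have [_ e n] := R3 q w isT];
    by split=> // [|i /n ne]; rewrite itE ?e // => -[].
- case=> [c|q] [y|w] //=.
  + have [_ _] := P2 c (inl y) isT isT; rewrite /allowed.
    by case: (f c _) => // z /andP[_ nz].
  + by have [_ _] := P2 c (inr w) isT isT; rewrite /allowed; case: (f c _).
  + exact: P4.
  + exact: R4.
- case=> [y|w] [z|v] n1 n2.
  + have [[c _ j]|[q j]] := P5 y z isT isT n1 n2; first by exists (inl c).
    by exists (inr q).
  + by have [c _ j] := P6 y v isT; exists (inl c).
  + by have [c _ j] := P6 z w isT; exists (inl c); rewrite joined_sym.
  + by have [q j] := R5 w v n1 n2; exists (inr q).
Qed.

Lemma table_factorization (n : nat) (fixed : bool) (lens : seq nat)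
    (phi : seq (seq nat)) (part : seq (seq (seq nat))) :
  incomplete_table n 0 fixed lens phi part [::] ->
  exists (ph : 'I_n -> 'I_n) (h : 'I_(size lens) -> 'I_n -> 'I_n),
    factorization (fun q : 'I_(size lens) => nth 0 lens q) fixed ph h /\
    forall x, val (ph x) = rot_cycles phi (val x).
Proof.
case/table_incomplete_on=> ph [f [h [[P1 _ P3 P4 P5 _] phE]]]; exists ph, h; split=> //.
split=> // [x | x | q x | x y n1 n2]; try by have [_ e1 e2] := P1 x isT.
  exact: P4.
by have [[[]]|] := P5 x y isT isT n1 n2.
Qed.

Lemma triangle_factorization :
  exists phi h, @factorization 'I_3 'I_1 (fun q => nth 0 [:: 3] q) true phi h.
Proof.
have [|ph [h [P _]]] := @table_factorization 3 true [:: 3] [::] [:: [:: [:: 0; 1; 2]]].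
  by vm_compute.
by exists ph, h.
Qed.

Definition octahedral_factorization (l : nat) : Prop :=
  exists (ph : 'I_6 -> 'I_6) (h : 'I_2 -> 'I_6 -> 'I_6),
    factorization (fun q : 'I_2 => nth 0 [:: l; 6] q) false ph h /\
    forall x, val (ph x) = rot_cycles octahedron_phi (val x).

Lemma octahedral_factorization_3 : octahedral_factorization 3.
Proof. by apply: (@table_factorization 6 _ [:: 3; 6] _ octahedron_36); vm_compute. Qed.

Lemma octahedral_factorization_6 : octahedral_factorization 6.
Proof. by apply: (@table_factorization 6 _ [:: 6; 6] _ octahedron_66); vm_compute. Qed.

(** Each triangle is numbered along [s] from its vertex of least [enum_rank]. *)
Lemma position_in_triple (Y : finType) (s : Y -> Y) :
  (forall x, s (s (s x)) = x) -> (forall x, s x != x) ->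
  exists pos : Y -> nat, forall x, pos x < 3 /\ pos (s x) = (pos x + 1) %% 3.
Proof.
move=> s3 sN.
pose e (x : Y) : nat := enum_rank x.
have e_inj : injective e by move=> x y /val_inj /enum_rank_inj.
have eN x : e (s x) <> e x by move/e_inj/eqP; apply/negP.
exists (fun x => if (e x < e (s x)) && (e x < e (s (s x))) then 0
  else if (e (s (s x)) < e x) && (e (s (s x)) < e (s x)) then 1 else 2) => x.
rewrite s3; have := eN x; have := eN (s x); have := eN (s (s x)); rewrite s3.
by repeat case: ifP; lia.
Qed.

(** * Doubling a triple system into octahedra *)

Section Doubling.

Variables (Y I : finType) (s : I -> Y -> Y) (l : I -> nat).
Hypotheses (s3 : forall i x, s i (s i (s i x)) = x) (sN : forall i x, s i x != x).
Hypothesis cover : forall x y, y != x -> exists i, joined (s i) x y.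
Hypothesis oct : forall i, octahedral_factorization (l i).

Let flip (u : Y * bool) := (u.1, ~~ u.2).

(** Two doubled points that are distinct and not exchanged by [flip] lie over different points,
    hence over one triangle of some class [i]. The two explicit factors of the octahedron over this
    triangle cover the pair; they are used in all octahedra of class [i] at once. *)
Lemma double_factorization :
  exists h, factorization (fun iq : I * 'I_2 => nth 0 [:: l iq.1; 6] iq.2) false flip h.
Proof.
have /fin_all_exists[pos posP] i := position_in_triple (s3 i) (sN i).
have /fin_all_exists[ph /fin_all_exists[h hP]] := oct.
have iter3 i n x : iter (n + 3) (s i) x = iter n (s i) x.
  by elim: n => [|n /= ->] //=; apply: s3.
have iter_mod i n x : iter (n %% 3) (s i) x = iter n (s i) x.
  rewrite [in RHS](divn_eq n 3) addnC; elim: (n %/ 3) => [|k IH]; first by rewrite addn0.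
  by rewrite mulSn addnCA addnC iter3.
have s_inj i : injective (s i) by move=> x y e; rewrite -(s3 i x) e s3.
have iter_inj i n : injective (iter n (s i)).
  by elim: n => [|n IH] x y //= /s_inj /IH.
have pos_iter i n x : pos i (iter n (s i) x) = (pos i x + n) %% 3.
  elim: n => [|n IH] /=; first by have [lt _] := posP i x; rewrite addn0 modn_small.
  by have [_ ->] := posP i (iter n (s i) x); rewrite IH modnDml addn1 addnS.
(* A point of the octahedron over the triangle through [u.1] is given by the first
   vertex [base i u] of the triangle and by a vertex [enc i u] of [octahedron_phi]. *)
pose base i (u : Y * bool) := iter (3 - pos i u.1) (s i) u.1.
pose enc i (u : Y * bool) : 'I_6 := inord (pos i u.1 + 3 * u.2).
have encE i u : val (enc i u) = pos i u.1 + 3 * u.2.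
  by rewrite /enc /= inordK //; have [lt _] := posP i u.1; case: (u.2) => /=; lia.
have code_inj i u v : base i u = base i v -> enc i u = enc i v -> u = v.
  case: u v => [x b] [y c] eb /(congr1 val); rewrite !encE /= => ee.
  have [x_lt _] := posP i x; have [y_lt _] := posP i y.
  have ep : pos i x = pos i y by move: ee; case: (b); case: (c) => /=; lia.
  congr (_, _); last by move: ee; case: (b); case: (c) => //=; lia.
  by move: eb; rewrite /base /= ep; apply: iter_inj.
(* The [3 - pos] steps lead back to the base of the triangle; from there [o %% 3] is the place in
   the triangle, and [3 <= o] tells the copy. *)
pose tau (iq : I * 'I_2) (u : Y * bool) : Y * bool :=
  let o : 'I_6 := h iq.1 iq.2 (enc iq.1 u) in
  (iter (o %% 3 + (3 - pos iq.1 u.1)) (s iq.1) u.1, 3 <= o).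
have tau_base i q u : base i (tau (i, q) u) = base i u.
  rewrite /base /tau /= pos_iter -iterD -[LHS]iter_mod -[RHS]iter_mod.
  have [lt _] := posP i u.1; congr iter; set o := nat_of_ord _ ; lia.
have tau_enc i q u : enc i (tau (i, q) u) = h i q (enc i u).
  apply: val_inj; rewrite encE /tau /= pos_iter; have [lt _] := posP i u.1.
  by case: (h i q _) => o o6 /=; case: (leqP 3 o) => /=; lia.
have flip_base i u : base i (flip u) = base i u by [].
have flip_enc i u : enc i (flip u) = ph i (enc i u).
  apply: val_inj; have [_ ->] := hP i; rewrite !encE /=; have [lt _] := posP i u.1.
  by case: (pos i u.1) lt => [|[|[|]]] // _; case: (u.2).
exists tau; split.
- by case=> x b; rewrite /flip negbK.
- by case=> x b; apply/eqP => -[]; case: b.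
- case=> i q u _; have [[_ _ /(_ q (enc i u) isT)[_ e n] _ _] _] := hP i.
  have it k : base i (iter k (tau (i, q)) u) = base i u /\
      enc i (iter k (tau (i, q)) u) = iter k (h i q) (enc i u).
    by elim: k => //= k [e1 e2]; rewrite tau_base tau_enc e1 e2.
  split=> // [|k /n ne].
    by apply: (code_inj i); [rewrite (it _).1 | rewrite (it _).2].
  by move/(congr1 (enc i)); rewrite (it _).2.
- case=> i q u; have [[_ _ _ n _] _] := hP i.
  by apply: contraNneq (n q (enc i u)) => e; rewrite -tau_enc e flip_enc.
move=> u v n1 n2.
have nx : v.1 != u.1.
  apply: contra n1 => /eqP e; case: u v n2 e => [x b] [y c] /= n2 e.
  by move: n2; rewrite e -!pair_eqE /= !eqxx /=; case: b; case: c.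
have [i j] := cover nx.
have bE : base i u = base i v.
  have step x : iter (3 - pos i (s i x)) (s i) (s i x) = iter (3 - pos i x) (s i) x.
    have [lt ->] := posP i x; rewrite -iterSr -[LHS]iter_mod -[RHS]iter_mod.
    by congr iter; lia.
  by case/orP: j => /eqP e; rewrite /base -e step.
have [[_ _ _ _ cov] _] := hP i.
have [||q jq] := cov (enc i u) (enc i v).
- by apply: contra_neq n1 => e; apply: (code_inj i).
- by apply: contra_neq n2 => e; apply: (code_inj i); rewrite ?flip_base ?flip_enc.
exists (i, q); case/orP: jq => /eqP e; apply/orP; [left | right]; apply/eqP;
  by apply: (code_inj i); rewrite ?tau_base ?tau_enc.
Qed.

End Doubling.

(** * From permutations to cycle factors *)

Definition edges_of (T : finType) (f : T -> T) : {set {set T}} :=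
  [set [set x; f x] | x : T].

Section Factor.

Variables (T : finType) (m : nat) (f : T -> T).
Hypotheses (m3 : 3 <= m) (fP : cycles_of_length predT m f).

Lemma iter_length x : iter m f x = x.
Proof. by have [_ ->] := fP (isT : predT x). Qed.

Lemma cycles_inj : injective f.
Proof.
move=> x y e; rewrite -(iter_length x) -(iter_length y).
by case: (m) m3 => // k _; rewrite !iterSr e.
Qed.

Lemma cycles_neq x : f x != x.
Proof. by have [_ _ n] := fP (isT : predT x); apply/eqP/(n 1); rewrite (leq_trans _ m3). Qed.

Lemma cycles_order x : order f x = m.
Proof.
have [_ _ n] := fP (isT : predT x).
apply/eqP; rewrite eqn_leq; apply/andP; split; last first.
  rewrite leqNgt; apply/negP => lt; apply: (n (order f x)); last exact: (iter_order cycles_inj).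
  by rewrite order_gt0.
have : fcycle f (traject f x m).
  case: (m) m3 (iter_length x) => // k _ e.
  by rewrite /= rcons_path fpath_traject last_traject /= -iterS e.
move=> cy; have := order_le_cycle cy (x := x); rewrite size_traject; apply.
by case: (m) m3 => // k _; rewrite inE eqxx.
Qed.

Lemma mem_edges x y : x != y -> ([set x; y] \in edges_of f) = joined f x y.
Proof.
move=> ne; apply/imsetP/orP => [[z _ /setP e] | [/eqP <- | /eqP <-]].
- have := e x; have := e y; rewrite !inE !eqxx orbT => /esym ey /esym ex.
  case/orP: ex ey ne => /eqP -> /orP[] /eqP ->; rewrite ?eqxx // => _; by [left | right].
- by exists x.
- by exists y; rewrite // setUC.
Qed.

Lemma connect_edges : connect (adj (edges_of f)) =2 fconnect f.
Proof.
move=> x y; apply/idP/idP; apply: connect_sub => {x y} x y /=.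
  have [->|ne] := eqVneq x y; first by move=> _; apply: connect0.
  rewrite /adj /= mem_edges // => /orP[] /eqP <-; first exact: fconnect1.
  by rewrite fconnect_sym ?fconnect1 //; apply: cycles_inj.
move=> /eqP <-; apply: connect1; rewrite /adj /= mem_edges; last by rewrite eq_sym cycles_neq.
by rewrite /joined eqxx.
Qed.

(** The components are the orbits of [f], and [orbit f x] lists one in cyclic order. *)
Lemma cycles_factor (G : {set {set T}}) : edges_of f \subset G -> cycle_factor m G (edges_of f).
Proof.
move=> sub; split=> // x; exists (orbit f x).
have V : component_vertices (edges_of f) x = [set y in orbit f x].
  by apply/setP => y; rewrite !inE connect_edges fconnect_orbit.
have nextE y : y \in orbit f x -> next (orbit f x) y = f y.
  by move=> yx; have /eqP -> := next_cycle (cycle_orbit cycles_inj x) yx.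
split=> //.
  by rewrite size_orbit cycles_order.
apply/setP => e; rewrite !inE V; apply/andP/imsetP => [[/imsetP[y _ ->] /subsetP s]|[y yx ->]].
  have yx : y \in orbit f x by have := s y; rewrite !inE eqxx => /(_ isT).
  by exists y; rewrite ?nextE.
rewrite nextE //; split; first by apply/imsetP; exists y.
apply/subsetP => z; rewrite !inE => /orP[] /eqP -> //.
by rewrite -fconnect_orbit; apply: connect_trans (fconnect1 f y); rewrite fconnect_orbit.
Qed.

End Factor.

Lemma cover_decomposition (T I : finType) (L : I -> nat) (phi : T -> T) (h : I -> T -> T) :
  factorization L false phi h -> (forall i, 3 <= L i) -> #|T| = 2 * #|I| + 2 ->
  one_factor (complete_graph T) (edges_of phi) /\
  decomposition (complete_graph T :\: edges_of phi) (fun i => edges_of (h i)).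
Proof.
case=> P1 P2 P3 P4 P5 L3 cT.
have edge x y : ([set x; y] \in complete_graph T) = (x != y).
  by rewrite inE cards2; case: (x != y).
have phiN x : phi x != x by rewrite P2.
have phi_edge x y : x != y -> ([set x; y] \in edges_of phi) = (y == phi x).
  move=> ne; apply/imsetP/eqP => [[z _ /setP e] | ->]; last by exists x.
  have := e x; have := e y; rewrite !inE !eqxx !orbT /=.
  move/esym => /orP[] /eqP ey /esym /orP[] /eqP ex; rewrite ey ex ?P1 //;
    by rewrite ey ex eqxx in ne.
split.
  split; first by apply/subsetP => _ /imsetP[x _ ->]; rewrite edge eq_sym phiN.
  move=> x; apply/eqP/cards1P; exists [set x; phi x]; apply/setP => e; rewrite !inE.
  apply/andP/eqP => [[/imsetP[y _ ->]]|->].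
    by rewrite !inE => /orP[] /eqP ->; rewrite // P1 setUC.
  by rewrite !inE eqxx; split=> //; apply/imsetP; exists x.
have hN i x := cycles_neq (L3 i) (P3 i) x.
split.
  apply/setP => e; rewrite !inE; apply/bigcupP/andP => [[i _ /imsetP[x _ ->]] | [nF c2]].
    have nx : x != h i x by rewrite eq_sym hN.
    by rewrite cards2 nx phi_edge // P4.
  have /cards2P[x [y [ne eE]]] := c2.
  rewrite eE phi_edge // in nF.
  have [||i j] := P5 x y; [by rewrite eq_sym | by [] |].
  by exists i; rewrite // eE mem_edges.
(* The [2 * #|I|] neighbours of [x] cover the [#|T| - 2] admissible ones, hence they
   are distinct. *)
pose nb x (ib : I * bool) := if ib.2 then h ib.1 x else iter (L ib.1).-1 (h ib.1) x.
have hpred i x : h i (iter (L i).-1 (h i) x) = x.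
  by rewrite -iterS prednK ?(iter_length (P3 i)) //; apply: leq_trans (L3 i).
have nb_inj x : injective (nb x).
  suff c : #|[seq nb x ib | ib in predT]| == #|{: I * bool}|.
    by move=> a b; apply: (image_injP c).
  rewrite eqn_leq leq_image_card card_prod card_bool /=.
  have cx : #|[set x; phi x]| = 2 by rewrite cards2 eq_sym phiN.
  have -> : #|I| * 2 = #|~: [set x; phi x]|.
    by have := cardsC [set x; phi x]; rewrite cx cT; lia.
  apply/subset_leq_card/subsetP => y; rewrite !inE negb_or => /andP[n1 n2].
  have [i j] := P5 x y n1 n2; apply/imageP.
  case/orP: j => /eqP e; [exists (i, true) | exists (i, false)] => //=.
  by apply: (cycles_inj (L3 i) (P3 i)); rewrite hpred.
(* An edge joining [x] and [h i x] that also belongs to class [j] would make [h i x] occur twice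
   among the neighbours [nb x]. *)
move=> i j ij; rewrite -setI_eq0; apply/eqP/setP => e; rewrite !inE.
apply/negP => /andP[/imsetP[x _ ->]] .
rewrite mem_edges 1?eq_sym ?hN // => /orP[] /eqP e'.
  have := nb_inj x (i, true) (j, true); rewrite /nb /= e' => /(_ erefl)[] /eqP.
  by rewrite (negbTE ij).
have := nb_inj x (i, true) (j, false); rewrite /nb /=.
have -> : h i x = iter (L j).-1 (h j) x.
  by apply: (cycles_inj (L3 j) (P3 j)); rewrite e' hpred.
by move=> /(_ erefl).
Qed.

Lemma factorization_transport (T T' : eqType) (I I' : Type) (L : I -> nat) (fixed : bool)
    (phi : T -> T) (h : I -> T -> T) (g : T' -> T) (k : T -> T') (c : I' -> I) (d : I -> I') :
  cancel g k -> cancel k g -> cancel d c -> factorization L fixed phi h ->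
  factorization (fun i => L (c i)) fixed (fun x => k (phi (g x)))
    (fun i x => k (h (c i) (g x))).
Proof.
move=> gK kK dK [P1 P2 P3 P4 P5].
have g_inj := can_inj gK; have k_inj := can_inj kK.
have eqk x y : (k x == y) = (x == g y) by rewrite -(inj_eq g_inj) kK.
split.
- by move=> x; rewrite kK P1.
- by move=> x; rewrite eqk.
- move=> i x _; have [_ e n] := P3 (c i) (g x) isT.
  have it j : iter j (fun x => k (h (c i) (g x))) x = k (iter j (h (c i)) (g x)).
    by elim: j => [|j IH] /=; rewrite ?gK // IH kK.
  by split=> // [|j /n ne]; rewrite it ?e ?gK // => /(congr1 g); rewrite kK.
- by move=> i x; rewrite (inj_eq k_inj).
move=> x y n1 n2; have [||i j] := P5 (g x) (g y).
- by rewrite (inj_eq g_inj).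
- by rewrite eq_sym -eqk eq_sym.
by exists (d i); rewrite /joined dK !eqk.
Qed.

Lemma factorization_HWP (T I : finType) (L : I -> nat) (phi : T -> T) (h : I -> T -> T)
    (v r s : nat) :
  factorization L false phi h -> ~~ odd v -> #|T| = v -> v = 2 * #|I| + 2 ->
  (forall i, L i = 3 \/ L i = 6) -> #|[pred i | L i == 3]| = r -> r + s = #|I| ->
  HWP 3 6 v r s.
Proof.
move=> P even_v cT vI L36 cr rs.
have [|g [k [gK kK]]] := @card_bijection 'I_v T; first by rewrite card_ord cT.
pose is3 (i : 'I_r + 'I_s) := if i is inl _ then true else false.
(* Classes are sorted by whether their length is 3, so that the [inl] indices receive the triangle
   factors. *)
have [b|c [d [cK dK cP]]] :=
    @fiber_bijection bool ('I_r + 'I_s)%type I is3 (fun i => L i == 3).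
  have cl : #|[pred i | is3 i == true]| = r.
    rewrite -[RHS]card_ord -(card_image (f := @inl 'I_r 'I_s)) => [|x y [] //].
    apply: eq_card => -[x|x]; rewrite !inE; apply/esym; first by apply/imageP; exists x.
    by apply/imageP => -[].
  have compl (X : finType) (p : X -> bool) :
      #|[pred i | p i == false]| = #|X| - #|[pred i | p i == true]|.
    rewrite -(cardC [pred i | p i == true]) addKn; apply: eq_card => i.
    by rewrite !inE; case: (p i).
  have c3 : #|[pred i | (L i == 3) == true]| = r.
    by rewrite -cr; apply: eq_card => i; rewrite !inE eqb_id.
  by case: b; rewrite ?compl cl c3 // card_sum !card_ord -rs.
have P' := factorization_transport gK kK dK P.
have L3 i : 3 <= L (c i) by case: (L36 (c i)) => ->.
have cI : #|{: 'I_r + 'I_s}| = #|I| by rewrite card_sum !card_ord.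
have [|oneF dec] := cover_decomposition P' L3; first by rewrite card_ord cI.
rewrite /HWP (negbTE even_v); exists (edges_of (fun x => k (phi (g x)))); split=> //.
exists (fun i => edges_of (fun x => k (h (c i) (g x)))); split=> // i; apply: cycles_factor => //.
- by have [_ _ P3 _ _] := P'; have := P3 (inl i); rewrite (eqP (cP (inl i))).
- by have [<- _] := dec; apply: bigcup_sup.
- have [_ _ P3 _ _] := P'; have := P3 (inr i); have := cP (inr i).
  by case: (L36 (c (inr i))) => ->.
- by have [<- _] := dec; apply: bigcup_sup.
Qed.

(** All [6 * t] full classes are triangle factors; the two partial ones, completed by an octahedron
    on the hole, have lengths [l] and 6. Thus [l = 3] gives [s = 1] and [l = 6] gives [s = 2]. *)
Lemma HWP_few_hexagons (l t : nat) :
  l = 3 \/ l = 6 -> octahedral_factorization l ->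
  incomplete 'I_6 (fun q : 'I_2 => nth 0 [:: l; 6] q) false t ->
  HWP 3 6 (12 * t + 6) (6 * t + (l == 3)) (1 + (l == 6)).
Proof.
move=> l36 [phW [hW [PW _]]] [Y [C [phi [f [h [cY cC P]]]]]].
apply: (factorization_HWP (incomplete_complete P PW)).
- by lia.
- by rewrite card_sum cY !card_ord; lia.
- by rewrite card_sum cC !card_ord; lia.
- by case=> [c|[[|[|]]]] //=; [left | right].
- rewrite -sum1_card big_mkcond big_sumType /= sum1_card cC card_ord !big_ord_recl big_ord0 !inE /=.
  by case: l36 => ->; rewrite /=; lia.
- by rewrite card_sum cC !card_ord; case: l36 => ->; lia.
Qed.

Lemma triangle_classes (T : eqType) (I : Type) (L : I -> nat) (phi : T -> T) (h : I -> T -> T) :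
  factorization L true phi h -> (forall i, L i = 3) ->
  [/\ forall i x, h i (h i (h i x)) = x, forall i x, h i x != x
    & forall x y, y != x -> exists i, joined (h i) x y].
Proof.
case=> _ phi1 hc hN cov L3; split=> [i x | i x | x y ne].
- by have [_] := hc i x isT; rewrite L3.
- by have := hN i x; rewrite (eqP (phi1 x)).
- by apply: cov; rewrite // (eqP (phi1 x)).
Qed.

(** Of the [3 * t + 1] parallel classes of the triple system, [r] double into a triangle factor and
    a hexagon factor, the others into two hexagon factors. *)
Lemma HWP_many_hexagons (t r s : nat) :
  r + s = 6 * t + 2 -> r <= 3 * t + 1 -> HWP 3 6 (12 * t + 6) r s.
Proof.
move=> rs r_le.
have [Y [C [phi [f [h [cY cC P]]]]]] := triple_incomplete_all t.
have [phW [hW PW]] := triangle_factorization.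
have [|sg3 sgN cover] := triangle_classes (incomplete_complete P PW).
  by case=> [c|[[|]]].
have cI : #|{: C + 'I_1}| = 3 * t + 1 by rewrite card_sum cC !card_ord muln1.
pose l (i : C + 'I_1) := if enum_rank i < r then 3 else 6.
have oct i : octahedral_factorization (l i).
  rewrite /l; case: ifP => _; first exact: octahedral_factorization_3.
  exact: octahedral_factorization_6.
have [g Pg] := double_factorization sg3 sgN cover oct.
apply: (factorization_HWP Pg).
- by lia.
- by rewrite card_prod card_sum cY card_bool !card_ord; lia.
- by rewrite card_prod cI card_ord; lia.
- case=> i [[|[|]]] //= _; rewrite /l; last by right.
  by case: ifP; [left | right].
- transitivity #|[pred i | l i == 3]|.
    rewrite -!sum1_card big_mkcond [RHS]big_mkcond /=.
    transitivity (\sum_i \sum_(q < 2) (nth 0 [:: l i; 6] q == 3)).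
      by rewrite pair_bigA; apply: eq_bigr => iq _; rewrite inE; case: eqP.
    by apply: eq_bigr => i _; rewrite !big_ord_recl big_ord0 !inE /=; case: (l i == 3).
  rewrite (eq_card (B := [pred i | enum_rank i < r])) => [|i].
    by rewrite card_rank_lt ?cI.
  by rewrite !inE /l; case: ifP.
- by rewrite card_prod cI card_ord; lia.
Qed.

Theorem theorem24 (y s r : nat) (hy0 : 0 < y) (hy : odd y)
  (hs : [\/ s = 1, s = 2 | (3 * (y - 1)) %/ 2 + 1 <= s <= 3 * y - 1])
  (hr : r = 3 * y - 1 - s) :
  HWP 3 6 (6 * y) r s.
Proof.
pose t := y./2; have yE : y = 2 * t + 1 by rewrite -(odd_double_half y) hy /t; lia.
have -> : 6 * y = 12 * t + 6 by lia.
case: hs => [s1 | s2 | s_ge].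
- have -> : r = 6 * t + (3 == 3) by rewrite /=; lia.
  rewrite s1; apply: (@HWP_few_hexagons 3); first by left.
    exact: octahedral_factorization_3.
  exact: octahedral_incomplete_36.
- have -> : r = 6 * t + (6 == 3) by rewrite /=; lia.
  rewrite s2; apply: (@HWP_few_hexagons 6); first by right.
    exact: octahedral_factorization_6.
  exact: octahedral_incomplete_66.
by apply: HWP_many_hexagons; lia.
Qed.
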